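(* There are piecewise linear holomorphic systems $$\dot z=F^+(z)\ \text{ when } \operatorname{Im}(z)>0,\qquad \dot z=F^-(z)\ \text{ when }\operatorname{Im}(z)<0,$$ with $F^\pm$ complex polynomials of $z$ of degree $1$, having at least $3$ limit cycles; that is, $\mathcal L_{1,1}\ge3$.
   Context: $z=x+iy$. Orbits on the discontinuity line $\operatorname{Im} z=0$ are defined by the Filippov convention. A limit cycle is an isolated periodic orbit. $\mathcal L_{n^+,n^-}\in\mathbb N\cup\{\infty\}$ denotes the maximum number of limit cycles that a system of the displayed form with $F^\pm$ complex polynomials of $z$, $\deg F^\pm=n^\pm$, can have. *)

(* Defs.v *)
From HB Require Import structures.
From mathcomp Require Import all_boot all_order all_algebra.
From mathcomp Require Import all_classical all_reals all_analysis.
From mathcomp Require Import complex.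

Set Implicit Arguments.
Unset Strict Implicit.
Unset Printing Implicit Defensive.
Import Order.TTheory GRing.Theory Num.Theory.
Import numFieldNormedType.Exports.
Local Open Scope classical_set_scope.
Local Open Scope ring_scope.
Local Open Scope complex_scope.

Section FilippovSystem.
Context {R : realType}.
Implicit Types (Fp Fm : {poly R[i]}) (gamma : R -> R[i]) (G : set R[i]).

(* The intervals `]s i, t i[ are pairwise disjoint; s i = t i is allowed and
   contributes nothing to either sum. *)
Definition abs_continuous (a b : R) (f : R -> R) : Prop :=
  forall e : R, 0 < e -> exists2 d : R, 0 < d &
    forall (n : nat) (s t : 'I_n -> R),
      (forall i, [/\ a <= s i, s i <= t i & t i <= b]) ->
      trivIset [set: 'I_n] (fun i => `]s i, t i[%classic) ->
      \sum_(i < n) (t i - s i) < d ->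
      \sum_(i < n) `|f (t i) - f (s i)| < e.

(* Set-valued Filippov vector field of the system given by Fp on Im z > 0 and
   Fm on Im z < 0: on the real line it is the segment joining Fp(z) to Fm(z). *)
Definition filippov_field Fp Fm (z : R[i]) : set R[i] :=
  if 0 < complex.Im z then [set Fp.[z]]
  else if complex.Im z < 0 then [set Fm.[z]]
  else [set l%:C * Fp.[z] + (1 - l)%:C * Fm.[z] | l in `[0 : R, 1]%classic].

(* R[i] carries no normed R-module structure, hence absolute continuity and
   derivatives with respect to the real time are taken coordinatewise. *)
Definition filippov_solution Fp Fm gamma : Prop :=
  let x t := complex.Re (gamma t) in
  let y t := complex.Im (gamma t) in
  (forall a b, abs_continuous a b x /\ abs_continuous a b y) /\
  {ae lebesgue_measure, forall t : R,
    exists2 v : R[i], filippov_field Fp Fm (gamma t) v &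
      is_derive (t : R^o) 1 (x : R^o -> R^o) (complex.Re v) /\
      is_derive (t : R^o) 1 (y : R^o -> R^o) (complex.Im v)}.

(* Periodic orbits are curves in the plane: two solutions with the same image
   (for instance time translates) give the same orbit. *)
Definition periodic_orbit Fp Fm G : Prop :=
  exists gamma, exists T : R,
    [/\ filippov_solution Fp Fm gamma,
        0 < T /\ forall t, gamma (t + T) = gamma t,
        exists s t, gamma s <> gamma t &
        range gamma = G].

(* The regular module R[i]^o is only a way of accessing the norm topology of
   the complex plane. *)
Definition limit_cycles Fp Fm : set (set R[i]) :=
  [set G | periodic_orbit Fp Fm G /\
    exists U : set R[i]^o, [/\ open U, G `<=` U &
      forall G', periodic_orbit Fp Fm G' -> G' `<=` U -> G' = G]].

Definition num_limit_cycles Fp Fm : \bar R := counting (limit_cycles Fp Fm).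

End FilippovSystem.

(* L_{np,nm}, with values in the natural numbers extended by +oo; a polynomial
   of degree n has size n.+1. *)
Definition max_limit_cycles (R : realType) (np nm : nat) : \bar R :=
  ereal_sup [set num_limit_cycles F.1 F.2 | F in
    [set F : {poly R[i]} * {poly R[i]} |
      size F.1 = np.+1 /\ size F.2 = nm.+1]].

(* Main.v *)
Require Import Defs.
From HB Require Import structures.
From mathcomp Require Import all_boot all_order all_algebra.
From mathcomp Require Import all_classical all_reals all_analysis.
From mathcomp Require Import complex.
From mathcomp Require Import measurable_realfun.
From mathcomp Require Import ring lra.

(** The system is [z' = a (z - p)] for [Im z > 0] and [z' = a (z + p)] for
    [Im z < 0], with [a = al + i], [p = 1 + i] and [al = 1/100]; it is invariant
    under [z |-> -z], and both foci are repelling.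

    On the real axis the upper field points down exactly for [x < 1 + al] and the
    lower one up exactly for [x > - (1 + al)], so the open interval between these
    two visible folds consists of stable sliding, with sliding velocity
    [slide_rate al * x] pointing away from 0.  A solution sliding to the right
    leaves at the fold [1 + al] along the upper spiral; as [al] is small, this
    spiral comes back to the axis inside [(0, 1)], and the orbit closes up.  Such a
    cycle is isolated because solutions merge into it.  Its image under [z |-> -z]
    is the second limit cycle.

    The third one is a crossing cycle through [a] and [-a] with [a > 2].  Half a
    turn leads from [b] to [-c] when [departure al b = arrival al c], so by
    symmetry the cycle is a zero of [displacement = departure - arrival].  This
    function is increasing on [[2, +oo[], negative at 2 and positive at infinity,
    hence half a turn moves crossing points away from [a]; a periodic orbit crossing
    the axis only where [|x| > 2] can therefore only cross it at [a] and [-a]. *)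

Set Implicit Arguments.
Unset Strict Implicit.
Unset Printing Implicit Defensive.
Import Order.TTheory GRing.Theory Num.Theory.
Import numFieldNormedType.Exports.
Local Open Scope classical_set_scope.
Local Open Scope ring_scope.
Local Open Scope complex_scope.

(** * Absolutely continuous functions *)

Section RealAnalysis.
Context {R : realType}.
Implicit Types (f g : R -> R) (a b c l t x y : R).
Local Notation mu := (@lebesgue_measure R).

(** At the supremum of the points of [[a, b]] where [P] holds, the local step carries [P] from a
    point just below it to one just above, so this supremum is [b] and is attained. *)
Lemma real_induction (P : R -> Prop) a b : a <= b -> P a ->
  (forall c, a <= c <= b -> exists2 d : R, 0 < d &
    forall x y, a <= x -> x <= c -> c <= y -> y <= b -> c - d < x -> y < c + d ->
      P x -> P y) -> P b.
Proof.
move=> leab Pa step.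
pose E : set R := [set x | a <= x <= b /\ P x]%classic.
have Ea : E a by split=> //; rewrite lexx.
have ubE : ubound E b by move=> x [/andP[]].
have supE : has_sup E by split; [exists a|exists b].
have aE : a <= sup E by apply: ub_le_sup => //; exists b.
have Eb : sup E <= b by apply: ge_sup => //; exists a.
have [|d d0 stepE] := step (sup E); first by rewrite aE.
have [x Ex] := sup_adherent d0 supE; have [/andP[ax xb] Px] := Ex => Edx.
have xE : x <= sup E by apply: ub_le_sup => //; exists b.
have [ltEb|] := ltP (sup E) b; last first.
  move=> bE; apply: (stepE x b) => //; lra.
pose y := Num.min b (sup E + d / 2).
have yb : y <= b by rewrite ge_min lexx.
have Ey : sup E < y by rewrite lt_min ltEb /=; lra.
have yd : y <= sup E + d / 2 by rewrite ge_min lexx orbT.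
have Py : P y by apply: (stepE x y) => //; lra.
suff : y <= sup E by lra.
by apply: ub_le_sup; [exists b|split=> //; apply/andP; split; lra].
Qed.

Lemma is_derive_growth f t l : is_derive (t : R^o) 1 (f : R^o -> R^o) l ->
  forall e, 0 < e -> exists2 d : R, 0 < d &
    forall s, `|s - t| < d -> `|f s - f t - l * (s - t)| <= e * `|s - t|.
Proof.
move=> [df dfE] e e0; move: df; rewrite /derivable -/(derive f t 1) => df.
have {}df : (fun h : R^o => h^-1 *: ((f \o shift t) (h *: 1) - f t)) @ 0^' --> (l : R^o).
  by rewrite -dfE; exact: df.
move/cvgrPdist_le : df => /(_ e e0).
move=> [d d0 dP].
exists d => // s std; have [->|st] := eqVneq s t.
  by rewrite !subrr mulr0 subrr normr0 mulr0.
have h0 : s - t != 0 by rewrite subr_eq0.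
have := dP (s - t); rewrite /= sub0r normrN => /(_ std h0).
have -> : (s - t)%:A = s - t :> R^o by rewrite /GRing.scale /= mulr1.
rewrite subrK => H.
have -> : f s - f t - l * (s - t) = - (l - (s - t)^-1 * (f s - f t)) * (s - t) by field.
by rewrite normrM normrN ler_wpM2r.
Qed.

(** Exceptional intervals are collected in a list, the rightmost one first, whereas absolute
    continuity is stated for indexed families; this passes from one to the other. *)
Lemma ord_seq_disjoint (s : seq (R * R)) :
  pairwise (fun p q : R * R => q.2 <= p.1) s ->
  trivIset [set: 'I_(size s)]
    (fun i => `](nth (0, 0) s i).1, (nth (0, 0) s i).2[%classic).
Proof.
move=> /(pairwiseP (0, 0)) ps.
have disj (i j : 'I_(size s)) : (i < j)%N ->
    (`](nth (0, 0) s i).1, (nth (0, 0) s i).2[ `&`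
     `](nth (0, 0) s j).1, (nth (0, 0) s j).2[)%classic = set0.
  move=> ij; have := ps i j (ltn_ord i) (ltn_ord j) ij => le.
  rewrite -subset0 => z [] /=; rewrite !in_itv /= => /andP[z1 z2] /andP[z3 z4].
  lra.
move=> i j _ _; have [ij|ij|/val_inj//] := ltngtP i j.
  by rewrite disj // => -[z].
by rewrite setIC disj // => -[z].
Qed.

(** The sum of the lengths is the measure of the disjoint union, which lies in [U]. *)
Lemma sum_length_le_measure n (s t : 'I_n -> R) (U : set R) :
  measurable U -> (forall i, s i <= t i) ->
  (forall i, `]s i, t i[ `<=` U)%classic ->
  trivIset [set: 'I_n] (fun i => `]s i, t i[%classic) ->
  ((\sum_(i < n) (t i - s i))%:E <= mu U)%E.
Proof.
move=> mU st sub triv.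
have <- : mu (\bigcup_(i in [set: 'I_n]) `]s i, t i[%classic) = (\sum_(i < n) (t i - s i))%:E.
  rewrite measure_fin_bigcup //; last exact: finite_finset.
  have -> : [set: 'I_n] = [set` enum 'I_n].
    by apply/seteqP; split => // i _ /=; rewrite mem_enum.
  rewrite -fsbig_seq ?enum_uniq // big_enum /= -sumEFin.
  apply: eq_bigr => i _; rewrite lebesgue_measure_itv /= lte_fin.
  by case: ltgtP (st i) => // -> _; rewrite subrr.
apply: le_measure; rewrite ?inE //.
  by apply: fin_bigcup_measurable => //; exact: finite_finset.
by move=> z [i _] /sub.
Qed.

(** Cover the null set where the derivative bound fails by a small open set, on
    which absolute continuity controls the variation of [f]. *)
Theorem abs_continuous_growth f a b c : a <= b -> abs_continuous a b f ->
  {ae mu, forall t, a < t < b ->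
    exists2 l, c <= l & is_derive (t : R^o) 1 (f : R^o -> R^o) l} ->
  c * (b - a) <= f b - f a.
Proof.
move=> leab acf [N [mN N0 subN]].
apply/ler_addgt0Pr => e0 e0_gt0.
(* The error [e0] is shared out: lowering the slope by [e] costs at most [e0 / 2], the variation of
   [f] over the exceptional intervals at most [e0 / 4], and [K] times their total length at most
   [e0 / 4]. *)
pose e := e0 / 2 / (b - a + 1).
have ba1 : 0 < b - a + 1 by lra.
have e_gt0 : 0 < e by rewrite /e !divr_gt0.
have ee : e * (b - a) <= e0 / 2.
  by rewrite /e -mulrA ler_piMr ?divr_ge0 ?(ltW e0_gt0)// mulrC ler_pdivrMr; lra.
have [|d1 d10 dP] := acf (e0 / 4); first by lra.
pose K : R := `|c - e|; have K0 : 0 <= K := normr_ge0 _.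
pose d := Num.min d1 (e0 / 4 / (K + 1)).
have d0 : 0 < d by rewrite lt_min d10 divr_gt0; lra.
have dd1 : d <= d1 by rewrite ge_min lexx.
have Kd : K * d <= e0 / 4.
  have : d <= e0 / 4 / (K + 1) by rewrite ge_min lexx orbT.
  move=> /(ler_wpM2l K0).
  move=> /le_trans; apply; rewrite mulrA ler_pdivrMr; last lra.
  by rewrite mulrC ler_wpM2l; lra.
(* The end points are added because the derivative is controlled only inside the interval. *)
pose N' : set R := (N `|` [set a; b])%classic.
have mN' : measurable N' by apply: measurableU => //; apply: measurableU.
have muN' : mu N' = 0%E.
  apply/(negligibleP mu mN')/negligibleU; first exact/negligibleP.
  apply/negligibleP; first exact: measurableU.
  exact/countable_lebesgue_measure0/finite_set_countable.
have fN' : (mu N' < +oo)%E by rewrite muN'.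
have [U [oU NU muU]] := lebesgue_regularity_outer mN' fN' d0.
have mU : measurable U by exact: open_measurable.
have {}muU : (mu U < d%:E)%E.
  have := @measureU2 _ _ _ mu _ _ mN' (measurableD mU mN').
  rewrite setDUK // => /le_lt_trans; apply.
  by apply: (eq_ind _ (fun z => (z + _ < _)%E) _ _ (esym muN')); rewrite add0e.
pose P x := exists2 s : seq (R * R),
  [/\ pairwise (fun p q : R * R => q.2 <= p.1) s,
      forall p, p \in s -> [/\ a <= p.1, p.1 <= p.2 & p.2 <= x] &
      forall p, p \in s -> (`]p.1, p.2[ `<=` U)%classic] &
  (c - e) * (x - a) - \sum_(p <- s) (`|f p.2 - f p.1| + K * (p.2 - p.1)) <= f x - f a.
have [s [ps s1 s2] s3] : P b.
  apply: (@real_induction P a b) => //.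
    by exists [::] => //; rewrite big_nil !subrr mulr0 subr0.
  (* Near a point of [N'] the interval from [x] to [y] lies in [U] and joins the list. Near any
     other point the linear approximation, used on both sides of [z], gives a slope of at least
     [c - e] and the list is kept. *)
  move=> z zab; have [zN|zN] := pselect (N' z).
    have : nbhs z U by apply: open_nbhs_nbhs; split => //; exact: NU.
    move=> /nbhs_normP[d' /= d'0 zU]; exists d' => // x y ax xz zy yb dx yd.
    move=> [s [ps s1 s2] s3].
    exists ((x, y) :: s).
      split.
      - by rewrite /= ps andbT; apply/allP => p /s1 [].
      - move=> p; rewrite inE => /predU1P[->/=|/s1[? ? ?]]; split => //; lra.
      - move=> p; rewrite inE => /predU1P[->/=|/s2//].
        move=> w; rewrite /= in_itv /= => /andP[w1 w2]; apply: zU => /=.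
        by rewrite ltr_norml; apply/andP; split; lra.
    rewrite big_cons /=.
    have := ler_norm (- (f y - f x)); rewrite normrN.
    have : (c - e) * (y - x) <= K * (y - x).
      by rewrite ler_wpM2r ?ler_norm //; lra.
    lra.
  have {}zN : ~ N z /\ z != a /\ z != b.
    split; first by move=> Nz; apply: zN; left.
    by split; apply/eqP => ?; apply: zN; right; [left|right].
  case: zN => zN [za zb].
  have zab' : a < z < b by rewrite !lt_neqAle eq_sym za zb zab.
  have [l cl dl] : exists2 l, c <= l & is_derive (z : R^o) 1 (f : R^o -> R^o) l.
    by apply: contrapT => nl; apply: zN; apply: subN => /= H; exact: nl (H zab').
  have [d' d'0 d'P] := is_derive_growth dl e_gt0.
  exists d' => // x y ax xz zy yb dx yd [s [ps s1 s2] s3].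
  exists s; first by split => // p /s1 [? ? ?]; split => //; lra.
  have := d'P x; rewrite ltr_distl => /(_ ltac:(apply/andP; split; lra)).
  rewrite (_ : `|x - z| = z - x); last by rewrite distrC ger0_norm; lra.
  rewrite ler_norml => /andP[_ Hx].
  have := d'P y; rewrite ltr_distl => /(_ ltac:(apply/andP; split; lra)).
  rewrite (_ : `|y - z| = y - z); last by rewrite ger0_norm; lra.
  rewrite ler_norml => /andP[Hy _].
  have : (c - e) * (y - x) <= (l - e) * (y - x) by rewrite ler_wpM2r //; lra.
  lra.
pose S i := (nth (0, 0) s i).1; pose T i := (nth (0, 0) s i).2.
have sizeP (i : 'I_(size s)) : nth (0, 0) s i \in s by rewrite mem_nth.
have triv := ord_seq_disjoint ps.
have sum_lt : \sum_(i < size s) (T i - S i) < d.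
  rewrite -lte_fin; apply: le_lt_trans muU.
  apply: (@sum_length_le_measure _ S T) => // i.
    by have [] := s1 _ (sizeP i).
  exact: s2 _ (sizeP i).
have := dP _ S T _ triv (lt_le_trans sum_lt dd1).
move=> /(_ (fun i => s1 _ (sizeP i))) => s4.
move: s3; rewrite (big_nth (0, 0)) big_mkord big_split /= -mulr_sumr.
have : K * \sum_(i < size s) (T i - S i) <= K * d by rewrite ler_wpM2l // ltW.
rewrite /T /S in s4 *; lra.
Qed.

End RealAnalysis.

Section AbsContinuity.
Context {R : realType}.
Implicit Types (f g df : R -> R) (a b c l t x y : R).
Local Notation mu := (@lebesgue_measure R).

Lemma ae_imply (P Q : R -> Prop) : (forall t, P t -> Q t) ->
  {ae mu, forall t, P t} -> {ae mu, forall t, Q t}.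
Proof.
move=> PQ [N [mN N0 sN]]; exists N; split => // t nQ; apply: sN => Pt.
exact/nQ/PQ.
Qed.

Lemma is_derive_continuous f t l :
  is_derive (t : R^o) 1 (f : R^o -> R^o) l -> {for t, continuous f}.
Proof.
by move=> [df _]; apply: differentiable_continuous; exact/derivable1_diffP.
Qed.

(** Fermat's rule, read off from the linear approximation at [t + h] and [t - h]. It will force the
    vertical velocity to vanish where a nonnegative [y] touches 0. *)
Lemma is_derive_local_min f t l d : 0 < d ->
  is_derive (t : R^o) 1 (f : R^o -> R^o) l ->
  (forall s, `|s - t| < d -> f t <= f s) -> l = 0.
Proof.
move=> d0 dl fmin; apply/eqP; rewrite -normr_le0; apply/ler_addgt0Pr => e e0.
rewrite add0r; have [d' d'0 d'P] := is_derive_growth dl e0.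
pose h := Num.min d d' / 2; have h0 : 0 < h by rewrite divr_gt0 // lt_min d0.
have hd : h < d by rewrite ltr_pdivrMr // gt_min; apply/orP; left; lra.
have hd' : h < d' by rewrite ltr_pdivrMr // gt_min; apply/orP; right; lra.
have := fmin (t + h); have := fmin (t - h).
have := d'P (t + h); have := d'P (t - h).
have -> : t + h - t = h by ring.
have -> : t - h - t = - h by ring.
rewrite !normrN !(gtr0_norm h0) => /(_ hd') + /(_ hd') + /(_ hd) + /(_ hd).
rewrite !ler_norml => /andP[A1 A2] /andP[A3 A4] A5 A6.
by apply/andP; split; rewrite -(ler_pM2r h0); lra.
Qed.

Lemma lipschitz_abs_continuous f a b K :
  (forall s t, a <= s -> s <= t -> t <= b -> `|f t - f s| <= K * (t - s)) ->
  abs_continuous a b f.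
Proof.
move=> lipf e e0; pose K' := Num.max K 0 + 1.
have K'0 : 0 < K' by rewrite ltr_wpDl // le_max lexx orbT.
have KK' : K <= K' by rewrite /K' -[leLHS]addr0 lerD // le_max lexx.
exists (e / K'); first by rewrite divr_gt0.
move=> n s t st _; rewrite ltr_pdivlMr // => /(le_lt_trans _); apply.
rewrite mulr_suml; apply: ler_sum => i _; have [as_ st_ tb] := st i.
apply: le_trans (lipf _ _ as_ st_ tb) _.
by rewrite mulrC ler_wpM2l // subr_ge0.
Qed.

Lemma abs_continuousN f a b : abs_continuous a b f -> abs_continuous a b (fun t => - f t).
Proof.
move=> acf e /acf [d d0 dP]; exists d => // n s t st tr sd.
rewrite (eq_bigr (fun i => `|f (t i) - f (s i)|)); first exact: dP st tr sd.
by move=> i _; rewrite -opprD normrN.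
Qed.

Lemma abs_continuousD f g a b : abs_continuous a b f -> abs_continuous a b g ->
  abs_continuous a b (fun t => f t + g t).
Proof.
move=> acf acg e e0; have e2 : 0 < e / 2 by lra.
have [d d0 dP] := acf _ e2; have [d' d'0 d'P] := acg _ e2.
exists (Num.min d d'); first by rewrite lt_min d0.
move=> n s t st tr; rewrite lt_min => /andP[sd sd'].
have -> : e = e / 2 + e / 2 by field.
apply: le_lt_trans (ltrD (dP _ _ _ st tr sd) (d'P _ _ _ st tr sd')).
rewrite -big_split; apply: ler_sum => i _ /=.
by rewrite opprD addrACA ler_normD.
Qed.

Lemma abs_continuous_dist f a b : abs_continuous a b f ->
  forall e, 0 < e -> exists2 d : R, 0 < d & forall s t,
    a <= s -> s <= t -> t <= b -> t - s < d -> `|f t - f s| < e.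
Proof.
move=> acf e /acf [d d0 dP]; exists d => // s t sa st tb sd.
have := dP 1%N (fun=> s) (fun=> t); rewrite !big_ord1; apply => //.
by move=> i j _ _ _; rewrite (ord1 i) (ord1 j).
Qed.

(** Real induction: over a length less than [d] the function changes by less than 1, so a bound up
    to [x] extends to [y] after adding 1. *)
Lemma abs_continuous_bounded f a b : a <= b -> abs_continuous a b f ->
  exists2 M : R, 0 < M & forall t, a <= t -> t <= b -> `|f t| <= M.
Proof.
move=> ab acf; have [d d0 dP] := abs_continuous_dist acf ltr01.
have [M MP] : exists M : R, forall t, a <= t -> t <= b -> `|f t| <= M.
  apply: (@real_induction R (fun b => exists M : R, forall t,
    a <= t -> t <= b -> `|f t| <= M) a b) => //.
    by exists `|f a| => t at_ ta; rewrite (_ : t = a) //; apply/le_anti/andP.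
  move=> c cab; exists (d / 2); first lra.
  move=> x y ax xc cy yb dx yd [M MP].
  exists (M + 1) => t at_ ty.
  have [tx|xt] := leP t x; first by apply: (le_trans (MP _ at_ tx)); lra.
  have := dP x t ax (ltW xt).
  move=> /(_ ltac:(lra)) /(_ ltac:(lra)) H.
  have := MP x ax (lexx _); rewrite (_ : f t = f x + (f t - f x)); last by ring.
  by have := ler_normD (f x) (f t - f x); lra.
exists (Num.max M 1); first by rewrite lt_max ltr01 orbT.
by move=> t at_ tb; apply: (le_trans (MP _ at_ tb)); rewrite le_max lexx.
Qed.

(** Both factors are bounded on [[a, b]], so the variation of the product is controlled by theirs.
    If [b < a], the only admissible family of intervals is empty. *)
Lemma abs_continuousM f g a b : abs_continuous a b f -> abs_continuous a b g ->
  abs_continuous a b (fun t => f t * g t).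
Proof.
have [ba|ab] := ltP b a.
  move=> _ _ e e0; exists 1 => // n s t st _ _.
  case: n s t st => [|n] s t st; first by rewrite big_ord0.
  by have [? ? ?] := st ord0; exfalso; lra.
move=> acf acg e e0.
have [M M0 MP] := abs_continuous_bounded ab acf.
have [M' M'0 M'P] := abs_continuous_bounded ab acg.
have e1 : 0 < e / 2 / M' by rewrite !divr_gt0.
have e2 : 0 < e / 2 / M by rewrite !divr_gt0.
have [d d0 dP] := acf _ e1; have [d' d'0 d'P] := acg _ e2.
exists (Num.min d d'); first by rewrite lt_min d0.
move=> n s t st tr; rewrite lt_min => /andP[sd sd'].
have := dP _ _ _ st tr sd; rewrite ltr_pdivlMr // => S1.
have := d'P _ _ _ st tr sd'; rewrite ltr_pdivlMr // => S2.
have -> : e = e / 2 + e / 2 by field.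
apply: le_lt_trans (ltrD S1 S2).
rewrite !mulr_suml -big_split; apply: ler_sum => i _ /=.
have [as_ st_ tb] := st i.
have -> : f (t i) * g (t i) - f (s i) * g (s i) =
  (f (t i) - f (s i)) * g (t i) + (g (t i) - g (s i)) * f (s i) by ring.
apply: le_trans (ler_normD _ _) _; rewrite !normrM.
by apply: lerD; rewrite ler_wpM2l // ?M'P ?MP //; lra.
Qed.

(** Mean value theorem, with the maximum of [|df|] on the segment as constant. *)
Lemma C1_lipschitz f df a b : (forall t, is_derive (t : R^o) 1 (f : R^o -> R^o) (df t)) ->
  continuous df -> exists2 K : R, 0 <= K &
    forall s t, a <= s -> s <= t -> t <= b -> `|f t - f s| <= K * (t - s).
Proof.
move=> fdf cdf; have [ba|ab] := ltP b a.
  by exists 0 => // s t *; exfalso; lra.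
have cn : {within `[a, b], continuous (fun t => `|df t|)}.
  apply: continuous_subspaceT => t.
  exact: (@continuous_comp _ _ _ df Num.norm t (cdf t) (@norm_continuous _ _ _)).
have [m mab mP] := EVT_max ab cn.
exists `|df m| => // s t as_ st tb.
move: st; rewrite le_eqVlt => /predU1P[->|st]; first by rewrite !subrr normr0 mulr0.
have [|c cst ->] := @MVT R f df s t st (fun x _ => fdf x).
  by apply: continuous_subspaceT => x; exact: is_derive_continuous (fdf x).
rewrite normrM [`|t - s|]ger0_norm ?subr_ge0 ?(ltW st) // ler_wpM2r ?subr_ge0 ?(ltW st) //.
by apply: mP; move: cst; rewrite !in_itv /= => /andP[? ?]; apply/andP; split; lra.
Qed.

Lemma C1_abs_continuous f df a b :
  (forall t, is_derive (t : R^o) 1 (f : R^o -> R^o) (df t)) ->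
  continuous df -> abs_continuous a b f.
Proof.
move=> fdf cdf; have [K _ KP] := C1_lipschitz a b fdf cdf.
exact: lipschitz_abs_continuous KP.
Qed.

Lemma abs_continuous_growth_ub f a b c : a <= b -> abs_continuous a b f ->
  {ae mu, forall t, a < t < b ->
    exists2 l, l <= c & is_derive (t : R^o) 1 (f : R^o -> R^o) l} ->
  f b - f a <= c * (b - a).
Proof.
move=> ab acf fP.
have := @abs_continuous_growth R (fun t => - f t) a b (- c) ab (abs_continuousN acf).
move=> /(_ _)/wrap[|H]; last lra.
apply: ae_imply fP => t + tab => /(_ tab)[l lc fl]; exists (- l); first lra.
exact: is_deriveN fl.
Qed.

(** Uniqueness for the linear equations below enters in this form: a solution pulled back by the
    flow has zero derivative almost everywhere. *)
Lemma abs_continuous_cst f a b : a <= b -> abs_continuous a b f ->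
  {ae mu, forall t, a < t < b -> is_derive (t : R^o) 1 (f : R^o -> R^o) 0} ->
  f b = f a.
Proof.
move=> ab acf fP; apply/eqP; rewrite eq_le; apply/andP; split.
  have := @abs_continuous_growth_ub f a b 0 ab acf.
  move=> /(_ _)/wrap[|H]; last lra.
  by apply: ae_imply fP => t + tab => /(_ tab) fl; exists 0.
have := @abs_continuous_growth R f a b 0 ab acf.
move=> /(_ _)/wrap[|H]; last lra.
by apply: ae_imply fP => t + tab => /(_ tab) fl; exists 0.
Qed.

Lemma abs_continuous_continuous f : (forall a b, abs_continuous a b f) -> continuous f.
Proof.
move=> acf t; apply/cvgrPdist_lt => e e0.
have [d d0 dP] := abs_continuous_dist (acf (t - 1) (t + 1)) e0.
near=> s.
have sd : `|t - s| < d by near: s; exact: (@cvgr_dist_lt _ _ _ _ _ id t cvg_id).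
have s1 : `|t - s| < 1 by near: s; exact: (@cvgr_dist_lt _ _ _ _ _ id t cvg_id).
move: sd s1 => /ltr_normlP[? ?] /ltr_normlP[? ?].
have [st|ts] := leP s t; first by apply: (dP s t); lra.
by rewrite distrC; apply: (dP t s); lra.
Unshelve. all: by end_near. Qed.

End AbsContinuity.

(** * Trajectories *)

Section SymmetricSystem.
Context {R : realType}.
Implicit Types (al : R) (x y : R -> R) (a b c r s t : R).
Local Notation mu := (@lebesgue_measure R).

Definition upper_poly al : {poly R[i]} := (al +i* 1) *: ('X - (1 +i* 1)%:P).
Definition lower_poly al : {poly R[i]} := (al +i* 1) *: ('X + (1 +i* 1)%:P).

(** The Filippov field in real coordinates; for [py = 0] the velocity is the convex
    combination [l * F+ + (1 - l) * F-]. *)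
Definition coord_field al (px py vx vy : R) : Prop :=
  [/\ 0 < py -> vx = al * (px - 1) - (py - 1) /\ vy = (px - 1) + al * (py - 1),
      py < 0 -> vx = al * (px + 1) - (py + 1) /\ vy = (px + 1) + al * (py + 1) &
      py = 0 -> exists2 l : R, 0 <= l <= 1 &
        vx = al * px + (1 - al) * (2 * l - 1) /\ vy = px - (1 + al) * (2 * l - 1)].

Definition coord_solution al x y : Prop :=
  (forall a b, abs_continuous a b x /\ abs_continuous a b y) /\
  {ae mu, forall t : R, exists vx vy : R,
    [/\ is_derive (t : R^o) 1 (x : R^o -> R^o) vx,
        is_derive (t : R^o) 1 (y : R^o -> R^o) vy &
        coord_field al (x t) (y t) vx vy]}.

Lemma size_upper_poly al : size (upper_poly al) = 2%N.
Proof.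
rewrite /upper_poly size_scale ?size_XsubC //.
by rewrite eq_complex /= oner_eq0 andbF.
Qed.

Lemma size_lower_poly al : size (lower_poly al) = 2%N.
Proof.
rewrite /lower_poly size_scale ?size_XaddC //.
by rewrite eq_complex /= oner_eq0 andbF.
Qed.

Lemma filippov_fieldE al (z v : R[i]) :
  filippov_field (upper_poly al) (lower_poly al) z v <->
  coord_field al (complex.Re z) (complex.Im z) (complex.Re v) (complex.Im v).
Proof.
case: z v => [zx zy] [vx vy]; rewrite /filippov_field /upper_poly /lower_poly /=.
rewrite !hornerE /=.
have [zy0|zy0|<-] := ltgtP 0 zy.
- split.
    by case=> -> ->; split=> [_||]; [split; ring|move=> ?; lra|move=> ?; lra].
  by case=> /(_ zy0)[-> ->] _ _ /=; congr (_ +i* _); ring.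
- split.
    by case=> -> ->; split=> [|_|]; [move=> ?; lra|split; ring|move=> ?; lra].
  by case=> _ /(_ zy0)[-> ->] _ /=; congr (_ +i* _); ring.
- split.
    case=> l; rewrite /= in_itv /= => l01 [<- <-]; split; rewrite ?ltxx //.
    by move=> _; exists l => //; split; ring.
  case=> _ _ /(_ erefl)[l l01 [-> ->]]; exists l; first by rewrite /= in_itv.
  by rewrite /=; congr (_ +i* _); ring.
Qed.

Lemma filippov_solutionE al (gamma : R -> R[i]) :
  filippov_solution (upper_poly al) (lower_poly al) gamma <->
  coord_solution al (fun t => complex.Re (gamma t)) (fun t => complex.Im (gamma t)).
Proof.
split=> -[ac sol]; split => //; apply: ae_imply sol => t.
  by move=> [v /filippov_fieldE vf [dx dy]]; exists (complex.Re v), (complex.Im v).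
move=> [vx [vy [dx dy vf]]]; exists (vx +i* vy) => //.
exact/filippov_fieldE.
Qed.

(** The map [z |-> -z] exchanges the two half planes and, on the axis, the weights [l] and
    [1 - l]. *)
Lemma coord_field_opp al (px py vx vy : R) :
  coord_field al px py vx vy -> coord_field al (- px) (- py) (- vx) (- vy).
Proof.
case=> pos neg zero; split.
- move=> h; have /neg[-> ->] : py < 0 by lra.
  by split; ring.
- move=> h; have /pos[-> ->] : 0 < py by lra.
  by split; ring.
- move=> h; have /zero[l l01 [-> ->]] : py = 0 by lra.
  by exists (1 - l); [lra|split; ring].
Qed.

Lemma coord_solution_opp al x y : coord_solution al x y ->
  coord_solution al (fun t => - x t) (fun t => - y t).
Proof.
case=> ac sol; split.
  by move=> a b; have [? ?] := ac a b; split; exact: abs_continuousN.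
apply: ae_imply sol => t [vx [vy [dx dy vf]]]; exists (- vx), (- vy); split.
- exact: is_deriveN dx.
- exact: is_deriveN dy.
- exact: coord_field_opp.
Qed.

Section Solution.
Variables (al : R) (x y : R -> R).
Hypothesis sol : coord_solution al x y.

Lemma solution_continuous_x : continuous x.
Proof. by apply: abs_continuous_continuous => a b; have [? _] := sol.1 a b. Qed.

Lemma solution_continuous_y : continuous y.
Proof. by apply: abs_continuous_continuous => a b; have [_ ?] := sol.1 a b. Qed.

Lemma solution_growth_y s t c : s <= t ->
  (forall r vx vy, s < r < t -> coord_field al (x r) (y r) vx vy -> c <= vy) ->
  c * (t - s) <= y t - y s.
Proof.
move=> st H; apply: abs_continuous_growth => //; first by have [] := sol.1 s t.
apply: ae_imply sol.2 => r [vx [vy [dx dy vf]]] rst; exists vy => //.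
exact: H vf.
Qed.

Lemma solution_growth_ub_y s t c : s <= t ->
  (forall r vx vy, s < r < t -> coord_field al (x r) (y r) vx vy -> vy <= c) ->
  y t - y s <= c * (t - s).
Proof.
move=> st H; apply: abs_continuous_growth_ub => //; first by have [] := sol.1 s t.
apply: ae_imply sol.2 => r [vx [vy [dx dy vf]]] rst; exists vy => //.
exact: H vf.
Qed.

(** The pulled back curve [exp (- (al + i) (u - s)) (z - p)] is constant; [c1] and [c2] are its real
    and imaginary parts. The rotation is then undone with [cos ^ 2 + sin ^ 2 = 1]. *)
Lemma solution_upper_arc s t : s <= t -> (forall r, s < r < t -> 0 < y r) ->
  x t = 1 + expR (al * (t - s)) * (cos (t - s) * (x s - 1) - sin (t - s) * (y s - 1)) /\
  y t = 1 + expR (al * (t - s)) * (sin (t - s) * (x s - 1) + cos (t - s) * (y s - 1)).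
Proof.
move=> st ypos.
pose E u := expR (- al * (u - s)).
pose C u := E u * cos (u - s); pose S u := E u * sin (u - s).
have dC u : is_derive (u : R^o) 1 (C : R^o -> R^o) (- al * C u - S u).
  by apply: (is_derive_eq _); rewrite /GRing.scale /= /C /S /E; ring.
have dS u : is_derive (u : R^o) 1 (S : R^o -> R^o) (- al * S u + C u).
  by apply: (is_derive_eq _); rewrite /GRing.scale /= /C /S /E; ring.
have dC' u : is_derive (u : R^o) 1 ((fun v => - al * C v - S v) : R^o -> R^o)
    (- al * (- al * C u - S u) - (- al * S u + C u)).
  by apply: (is_derive_eq _); rewrite /GRing.scale /=; ring.
have dS' u : is_derive (u : R^o) 1 ((fun v => - al * S v + C v) : R^o -> R^o)
    (- al * (- al * S u + C u) + (- al * C u - S u)).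
  by apply: (is_derive_eq _); rewrite /GRing.scale /=; ring.
have acC : abs_continuous s t C.
  by apply: (C1_abs_continuous _ _ dC) => u; exact: is_derive_continuous (dC' u).
have acS : abs_continuous s t S.
  by apply: (C1_abs_continuous _ _ dS) => u; exact: is_derive_continuous (dS' u).
have [acx acy] := sol.1 s t.
have accst c : abs_continuous s t (fun=> c).
  by apply: (@lipschitz_abs_continuous _ _ _ _ 0) => *; rewrite subrr normr0 mul0r.
pose c1 u := C u * (x u + -1) + S u * (y u + -1).
pose c2 u := C u * (y u + -1) + - (S u * (x u + -1)).
have X1 : abs_continuous s t (fun u => x u + -1) by exact: abs_continuousD.
have Y1 : abs_continuous s t (fun u => y u + -1) by exact: abs_continuousD.
have c1E : c1 t = c1 s.
  apply: abs_continuous_cst => //.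
    by apply: abs_continuousD; exact: abs_continuousM.
  apply: ae_imply sol.2 => r [vx [vy [dx dy vf]]] rst.
  have [/(_ (ypos _ rst))[vxE vyE] _ _] := vf.
  apply: (is_derive_eq _); rewrite /GRing.scale /= vxE vyE; ring.
have c2E : c2 t = c2 s.
  apply: abs_continuous_cst => //.
    by apply: abs_continuousD; [|apply: abs_continuousN]; exact: abs_continuousM.
  apply: ae_imply sol.2 => r [vx [vy [dx dy vf]]] rst.
  have [/(_ (ypos _ rst))[vxE vyE] _ _] := vf.
  apply: (is_derive_eq _); rewrite /GRing.scale /= vxE vyE; ring.
move: c1E c2E; rewrite /c1 /c2 /C /S /E !subrr mulr0 expR0 cos0 sin0.
rewrite !mul1r !mul0r addr0 subr0 mulNr expRN.
have := cos2Dsin2 (t - s); have := expR_gt0 (al * (t - s)).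
set e := expR _; set co := cos _; set si := sin _ => e0 cs h1 h2.
rewrite -h1 -h2.
have e0' : e != 0 by rewrite gt_eqF.
split.
  transitivity (1 + (co ^+ 2 + si ^+ 2) * (x t - 1)); last by field.
  by rewrite cs; ring.
transitivity (1 + (co ^+ 2 + si ^+ 2) * (y t - 1)); last by field.
by rewrite cs; ring.
Qed.

End Solution.
End SymmetricSystem.

(** * Zeros of continuous functions and periodic functions *)

Section Periodic.
Context {R : realType}.
Implicit Types (f x y : R -> R) (a b c d r s t : R).

Lemma continuous_gt f t c : continuous f -> c < f t ->
  exists2 d, 0 < d & forall r, `|r - t| <= d -> c < f r.
Proof.
move=> cf ctf; have e0 : 0 < f t - c by rewrite subr_gt0.
have /cvgrPdist_lt/(_ _ e0)/nbhs_normP[d /= d0 dP] := cf t.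
exists (d / 2); first lra.
move=> r rt; have : ball_ Num.norm t d r by rewrite /= distrC; lra.
by move/dP => /ltr_normlP[? ?]; lra.
Qed.

(** The time is the infimum of the times where [f <= 0]; continuity excludes both strict signs
    there. *)
Lemma first_zero f a b : continuous f -> a <= b -> 0 < f a -> f b <= 0 ->
  exists t, [/\ a < t, t <= b, f t = 0 & forall r, a <= r -> r < t -> 0 < f r].
Proof.
move=> cf ab fa fb.
pose E := [set r | a <= r /\ r <= b /\ f r <= 0].
have infE : has_inf E.
  by split; [exists b|exists a => r []].
have aE : a <= inf E by apply: lb_le_inf => //; [exists b|move=> r []].
have Eb : inf E <= b by apply: ge_inf; [exact: infE.2|].
have below r : a <= r -> r < inf E -> 0 < f r.
  move=> ar rE; rewrite ltNge; apply/negP => fr.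
  suff : inf E <= r by lra.
  by apply: ge_inf; [exact: infE.2|split=> //; split => //; lra].
have fE : f (inf E) <= 0.
  rewrite leNgt; apply/negP => /(continuous_gt cf)[d d0 dP].
  have [r [ar [rb fr]]] := inf_adherent d0 infE => rE.
  have Er : inf E <= r by apply: ge_inf; [exact: infE.2|].
  have := dP r; rewrite ger0_norm; last lra.
  by move=> /(_ ltac:(lra)); lra.
have aE' : a < inf E.
  by move: aE; rewrite le_eqVlt => /predU1P[aE|//]; rewrite aE in fa; lra.
exists (inf E); split => //; apply/eqP; rewrite eq_le fE leNgt /=; apply/negP => fE0.
have cNf : continuous (fun r => - f r) by move=> r; exact: continuousN (cf r).
have fE1 : 0 < - f (inf E) by lra.
have [d d0 dP] := continuous_gt cNf fE1.
pose r := Num.max a (inf E - d).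
have ar : a <= r by rewrite le_max lexx.
have dr : inf E - d <= r by rewrite le_max lexx orbT.
have rE : r < inf E by rewrite gt_max aE' /=; lra.
have := below r ar rE; have := dP r; rewrite distrC ger0_norm; last lra.
by move=> /(_ ltac:(lra)); lra.
Qed.

Lemma last_zero f a b : continuous f -> a <= b -> f a <= 0 -> 0 < f b ->
  exists t, [/\ a <= t, t < b, f t = 0 & forall r, t < r -> r <= b -> 0 < f r].
Proof.
move=> cf ab fa fb.
have cg : continuous (fun r => f (- r)).
  move=> r; apply: (@continuous_comp _ _ _ (fun r : R => - r) f r); last exact: cf.
  exact: opp_continuous.
have [||| t [bt ta ft tP]] := @first_zero (fun r => f (- r)) (- b) (- a) cg.
- lra.
- by rewrite opprK.
- by rewrite opprK.
exists (- t); split => //; try lra.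
by move=> r tr rb; rewrite -[r]opprK; apply: tP; lra.
Qed.

Lemma periodic_mul (A : Type) (g : R -> A) T : (forall t, g (t + T) = g t) ->
  forall (m : int) t, g (t + m%:~R * T) = g t.
Proof.
move=> gT; have gn (n : nat) t : g (t + n%:R * T) = g t.
  elim: n => [|n IH]; first by rewrite mul0r addr0.
  by rewrite mulrSr mulrDl mul1r addrA gT.
move=> [n|n] t; first exact: gn.
rewrite NegzE mulrNz mulNr -[LHS](gn n.+1); congr g.
by rewrite pmulrn subrK.
Qed.

Lemma periodic_representative (A : Type) (g : R -> A) T : 0 < T ->
  (forall t, g (t + T) = g t) ->
  forall s t, exists r, [/\ s <= r, r < s + T & g r = g t].
Proof.
move=> T0 gT s t; pose m := Num.floor ((t - s) / T).
exists (t + (- m)%:~R * T); split; last exact: periodic_mul.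
  have : m%:~R <= (t - s) / T by exact: ge_floor.
  by rewrite ler_pdivlMr // mulrNz mulNr; lra.
have : (t - s) / T < (m + 1)%:~R by exact: floorD1_gt.
by rewrite ltr_pdivrMr // mulrNz mulNr intrD mulrDl mul1r; lra.
Qed.

End Periodic.

(** * Upward crossings and periodic orbits inside the upper half plane *)

Section Trajectories.
Context {R : realType}.
Variables (al : R) (x y : R -> R).
Hypothesis sol : coord_solution al x y.
Implicit Types (a b c d r s t : R).

Let cx := solution_continuous_x sol.
Let cy := solution_continuous_y sol.

Lemma continuous_lincomb k m n : continuous (fun t => k + m * x t + n * y t).
Proof.
move=> t; apply: cvgD; first apply: cvgD; first exact: cvg_cst.
  by apply: cvgM; [exact: cvg_cst|exact: cx].
by apply: cvgM; [exact: cvg_cst|exact: cy].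
Qed.

Lemma crossing_upward t : 0 < al -> y t = 0 -> 1 + al < x t ->
  exists2 d, 0 < d & (forall r, t < r -> r <= t + d -> 0 < y r) /\
                     (forall r, t - d <= r -> r < t -> y r < 0).
Proof.
move=> al0 yt xt; pose c := (x t - (1 + al)) / 2.
have c0 : 0 < c by rewrite /c; lra.
have [d d0 dP] : exists2 d, 0 < d & forall r, `|r - t| <= d ->
    c < - (1 + al) + 1 * x r + al * y r.
  apply: continuous_gt; first exact: continuous_lincomb.
  by rewrite yt /c; lra.
have grow s r : t - d <= s -> s < r -> r <= t + d -> y s < y r.
  move=> ts sr rt; suff : c * (r - s) <= y r - y s.
    have : 0 < c * (r - s) by rewrite mulr_gt0 // subr_gt0.
    by lra.
  apply: (solution_growth_y sol); first lra.
  move=> u vx vy sur [pos neg zero].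
  have ub : c < - (1 + al) + 1 * x u + al * y u.
    by apply: dP; rewrite ler_norml; lra.
  have [uy|uy|uy] := ltgtP 0 (y u).
  - by have [_ ->] := pos uy; lra.
  - by have [_ ->] := neg uy; lra.
  - have [l l01 [_ ->]] := zero (esym uy).
    have : 0 <= (1 + al) * (1 - l) by rewrite mulr_ge0; lra.
    by rewrite -uy in ub; lra.
exists d => //; split => r h1 h2; first by rewrite -yt; apply: grow; lra.
by rewrite -yt; apply: grow; lra.
Qed.

(** Over one period the distance to the focus is multiplied by [expR (al * T) > 1], so periodicity
    forces it to be 0. *)
Lemma periodic_upper_constant T : 0 < al -> 0 < T ->
  (forall t, x (t + T) = x t) -> (forall t, y (t + T) = y t) ->
  (forall t, 0 < y t) -> forall t, x t = 1 /\ y t = 1.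
Proof.
move=> al0 T0 xT yT ypos t.
have tT : t <= t + T by lra.
have [xE yE] := solution_upper_arc sol tT (fun r _ => ypos r).
move: xE yE; rewrite xT yT addrAC subrr add0r.
have : 1 < expR (al * T) by rewrite expR_gt1 mulr_gt0.
have := cos2Dsin2 T; set e := expR _; set co := cos _; set si := sin _ => cs e1.
set X := x t; set Y := y t => xE yE.
have A : X - 1 = e * (co * (X - 1) - si * (Y - 1)) by rewrite {1}xE; ring.
have B : Y - 1 = e * (si * (X - 1) + co * (Y - 1)) by rewrite {1}yE; ring.
have E : (X - 1) ^+ 2 + (Y - 1) ^+ 2 = e ^+ 2 * ((X - 1) ^+ 2 + (Y - 1) ^+ 2).
  transitivity (e ^+ 2 * (co ^+ 2 + si ^+ 2) * ((X - 1) ^+ 2 + (Y - 1) ^+ 2));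
    last by rewrite cs mulr1.
  by apply: (etrans (congr2 (fun p q => p ^+ 2 + q ^+ 2) A B)); ring.
have e2 : 1 < e ^+ 2 by rewrite exprn_egt1.
have XY : (X - 1) ^+ 2 + (Y - 1) ^+ 2 = 0.
  apply/eqP; have : (e ^+ 2 - 1) * ((X - 1) ^+ 2 + (Y - 1) ^+ 2) = 0.
    by rewrite mulrBl mul1r -E subrr.
  by move/eqP; rewrite mulf_eq0 => /orP[/eqP|//]; lra.
move/eqP: XY; rewrite paddr_eq0 ?sqr_ge0 // !sqrf_eq0 !subr_eq0.
by move=> /andP[/eqP -> /eqP ->].
Qed.

End Trajectories.

(** * Image of a periodic curve that follows a loop *)

Section LoopRange.
Context {R : realType}.

Definition concat (A : Type) (t1 : R) (g h : R -> A) (r : R) : A :=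
  if r <= t1 then g r else h (r - t1).

(** Filippov solutions may merge, so only forward uniqueness from [p] is assumed. The curve is back
    at [p] at each time [s0 + n * L], and by periodicity each of its values is taken after [s0]. *)
Lemma range_loop (A : Type) (g loop : R -> A) (p : A) (T L s0 : R) :
  0 < T -> (forall t, g (t + T) = g t) -> 0 < L -> g s0 = p -> loop L = p ->
  (forall s, g s = p -> forall r, 0 <= r -> r <= L -> g (s + r) = loop r) ->
  range g = loop @` `[0, L].
Proof.
move=> T0 gT L0 gs0 loopL follow.
have gn (n : nat) : g (s0 + n%:R * L) = p.
  elim: n => [|n IH]; first by rewrite mul0r addr0.
  rewrite mulrSr mulrDl mul1r addrA (follow _ IH) //; lra.
apply/seteqP; split => z [t].
  move=> _ <-; have [r [sr _ <-]] := periodic_representative T0 gT s0 t.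
  have q0 : 0 <= (r - s0) / L by rewrite divr_ge0; lra.
  pose n := Num.truncn ((r - s0) / L).
  have /andP[n1 n2] := truncn_itv q0.
  move: n1 n2; rewrite -/n ler_pdivlMr // ltr_pdivrMr // mulrSr mulrDl mul1r => n1 n2.
  exists (r - (s0 + n%:R * L)); first by rewrite /= in_itv /=; lra.
  rewrite -(follow _ (gn n)); [congr g; ring|lra|lra].
rewrite /= in_itv /= => t0L <-; exists (s0 + t) => //.
by apply: follow => //; lra.
Qed.

End LoopRange.

(** * Forward motion along spirals and along the sliding segment *)

Section Following.
Context {R : realType}.
Variables (al : R) (x y : R -> R).
Hypothesis sol : coord_solution al x y.
Implicit Types (a b c d r s t : R).
Local Notation mu := (@lebesgue_measure R).

Let cy := solution_continuous_y sol.

(** [arc_x] and [arc_y] follow the upper spiral issued from the point [a] of the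
    real axis. *)
Definition arc_x (al a r : R) := 1 + expR (al * r) * (cos r * (a - 1) + sin r).
Definition arc_y (al a r : R) := 1 + expR (al * r) * (sin r * (a - 1) - cos r).
(** The convex combination with zero vertical velocity satisfies [2 * l - 1 = x / (1 + al)]; its
    horizontal velocity is this rate times [x]. *)
Definition slide_rate (al : R) := al + (1 - al) / (1 + al).

Lemma upper_arc s t : s <= t -> y s = 0 -> (forall r, s < r < t -> 0 < y r) ->
  x t = arc_x al (x s) (t - s) /\ y t = arc_y al (x s) (t - s).
Proof.
move=> st ys ypos; have [-> ->] := solution_upper_arc sol st ypos.
by rewrite ys /arc_x /arc_y; split; ring.
Qed.

(** At a first return to the axis before time [t1] the solution would still be on the spiral, where
    [arc_y] is positive. The hypothesis on [d] gets the solution off the axis. *)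
Lemma follow_upper_arc s t1 d : y s = 0 -> 0 < d ->
  (forall r, s < r -> r <= s + d -> 0 < y r) ->
  (forall r, 0 < r -> r < t1 -> 0 < arc_y al (x s) r) ->
  forall r, 0 <= r -> r <= t1 -> x (s + r) = arc_x al (x s) r /\ y (s + r) = arc_y al (x s) r.
Proof.
move=> ys d0 dP arcP r r0 rt1.
have ypos u : s < u < s + t1 -> 0 < y u.
  move=> su; rewrite ltNge; apply/negP => yu.
  pose a := Num.min (s + d) u.
  have ad : a <= s + d by rewrite ge_min lexx.
  have au : a <= u by rewrite ge_min lexx orbT.
  have sa : s < a by rewrite lt_min; lra.
  have [t [at_ tu yt tP]] := first_zero cy au (dP a sa ad) yu.
  have st : s <= t by lra.
  have [|_] := upper_arc st ys.
    move=> v sv; have [va|av] := leP v a; first by apply: dP; lra.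
    by apply: tP; lra.
  by have := arcP (t - s); rewrite yt => /(_ ltac:(lra) ltac:(lra)); lra.
have sr : s <= s + r by lra.
have [|-> ->] := upper_arc sr ys; first by move=> v sv; apply: ypos; lra.
by rewrite addrAC subrr add0r.
Qed.

Section Nonnegative.
Hypothesis y_ge0 : forall t, 0 <= y t.

(** Each zero of [y] is a minimum, so the vertical velocity vanishes there, and this determines the
    weight of the convex combination. *)
Lemma nonneg_field : 0 < al -> {ae mu, forall t : R, exists2 vx : R,
    is_derive (t : R^o) 1 (x : R^o -> R^o) vx &
    (0 < y t -> vx = al * (x t - 1) - (y t - 1)) /\
    (y t = 0 -> vx = slide_rate al * x t)}.
Proof.
move=> al0; apply: ae_imply sol.2 => t [vx [vy [dx dy [pos _ zero]]]].
exists vx => //; split; first by move=> /pos[].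
move=> yt; have vy0 : vy = 0.
  by apply: (is_derive_local_min ltr01 dy) => s _; rewrite yt.
have [l _ [-> vyE]] := zero yt.
have a1 : 1 + al != 0 by rewrite gt_eqF //; lra.
have -> : x t = (1 + al) * (2 * l - 1) by lra.
by rewrite /slide_rate; field.
Qed.

(** To the right of the fold the axis is crossed upward, so [y] would have been negative just
    before. *)
Lemma zero_le_fold t : 0 < al -> y t = 0 -> x t <= 1 + al.
Proof.
move=> al0 yt; rewrite leNgt; apply/negP => xt.
have [d d0 [_ dP]] := crossing_upward sol al0 yt xt.
have : y (t - d) < 0 by apply: dP; lra.
by have := y_ge0 (t - d); lra.
Qed.

(** Near a point to the left of the fold the upper field points down, so [y] cannot grow from 0 to a
    positive value. *)
Lemma sticks_to_line t : y t = 0 -> x t < 1 + al ->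
  exists2 d, 0 < d & forall r, t <= r -> r <= t + d -> y r = 0.
Proof.
move=> yt xt.
have [d d0 dP] : exists2 d, 0 < d & forall r, `|r - t| <= d ->
    0 < (1 + al) + (-1) * x r + (- al) * y r.
  apply: continuous_gt; first exact: (continuous_lincomb sol).
  by rewrite yt; lra.
exists d => // r tr rd; apply/eqP; rewrite eq_le y_ge0 andbT leNgt; apply/negP => yr.
have yt' : y t <= 0 by rewrite yt.
have [s [ts sr ys sP]] := last_zero cy tr yt' yr.
have := @solution_growth_ub_y _ _ _ _ sol s r 0 (ltW sr).
move=> /(_ _)/wrap[|]; last lra.
move=> u vx vy sur [pos _ _]; have [|_ ->] := pos; first by apply: sP; lra.
suff : 0 < (1 + al) + (-1) * x u + (- al) * y u by lra.
by apply: dP; rewrite ger0_norm; lra.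
Qed.

Lemma slide_on_line s t : 0 < al -> s <= t -> (forall r, s <= r -> r <= t -> y r = 0) ->
  x t = x s * expR (slide_rate al * (t - s)).
Proof.
move=> al0 st y0; set k := slide_rate al.
have dE u : is_derive (u : R^o) 1
    ((fun u => expR (- k * (u - s))) : R^o -> R^o) (- k * expR (- k * (u - s))).
  by apply: (is_derive_eq _); rewrite /GRing.scale /=; ring.
have dE' u : is_derive (u : R^o) 1
    ((fun u => - k * expR (- k * (u - s))) : R^o -> R^o)
    (- k * (- k * expR (- k * (u - s)))).
  by apply: (is_derive_eq _); rewrite /GRing.scale /=; ring.
have acE : abs_continuous s t (fun u => expR (- k * (u - s))).
  by apply: (C1_abs_continuous _ _ dE) => u; exact: is_derive_continuous (dE' u).
have [acx _] := sol.1 s t.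
have : x t * expR (- k * (t - s)) = x s * expR (- k * (s - s)).
  apply: (abs_continuous_cst st (abs_continuousM acx acE)).
  apply: ae_imply (nonneg_field al0) => u [vx dx [_ zero]] sut.
  have vxE : vx = k * x u by apply: zero; apply: y0; lra.
  by apply: (is_derive_eq _); rewrite /GRing.scale /= vxE; ring.
rewrite subrr mulr0 expR0 mulr1 => <-.
by rewrite -mulrA -expRD mulNr addNr expR0 mulr1.
Qed.

(** Suppose that the solution leaves the axis and consider the infimum of the times with [y > 0]. Up
    to it the sliding formula holds and puts the solution strictly before the fold, where it has to
    stay on the axis a little longer. *)
Lemma follow_slide s r : 0 < al -> al <= 1 -> y s = 0 -> 0 < x s -> 0 <= r ->
  x s * expR (slide_rate al * r) <= 1 + al ->
  x (s + r) = x s * expR (slide_rate al * r) /\ y (s + r) = 0.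
Proof.
move=> al0 al1 ys xs r0 xr.
have k0 : 0 < slide_rate al by rewrite /slide_rate ltr_pwDl // divr_ge0; lra.
suff y0 u : s <= u -> u <= s + r -> y u = 0.
  split; last by apply: y0; lra.
  have sr : s <= s + r by lra.
  by rewrite (slide_on_line al0 sr y0) addrAC subrr add0r.
move=> su ur; apply/eqP; rewrite eq_le y_ge0 andbT leNgt; apply/negP => yu.
pose E := [set t | s <= t /\ 0 < y t].
have infE : has_inf E by split; [exists u|exists s => t []].
have sE : s <= inf E by apply: lb_le_inf; [exists u|move=> t []].
have Eu : inf E <= u by apply: ge_inf; [exact: infE.2|].
have below t : s <= t -> t < inf E -> y t = 0.
  move=> st tE; apply/eqP; rewrite eq_le y_ge0 andbT leNgt; apply/negP => yt.
  suff : inf E <= t by lra.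
  by apply: ge_inf; [exact: infE.2|].
have yE : y (inf E) = 0.
  apply/eqP; rewrite eq_le y_ge0 andbT leNgt; apply/negP => yE0.
  have ys' : y s <= 0 by rewrite ys.
  have [t [st tE _ /(_ ((t + inf E) / 2))]] := last_zero cy sE ys' yE0.
  move=> /(_ ltac:(lra) ltac:(lra)); rewrite below; lra.
have y0 t : s <= t -> t <= inf E -> y t = 0.
  by move=> st; rewrite le_eqVlt => /predU1P[->//|]; exact: below.
have Eu' : inf E < u.
  by rewrite lt_neqAle Eu andbT; apply/eqP => EE; rewrite -EE in yu; lra.
have [|d d0 dP] := sticks_to_line yE.
  rewrite (slide_on_line al0 sE y0); apply: lt_le_trans xr.
  by rewrite ltr_pM2l // ltr_expR ltr_pM2l //; lra.
have [t [st yt] tE] := inf_adherent d0 infE.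
have Et : inf E <= t by apply: ge_inf; [exact: infE.2|].
by rewrite dP in yt; lra.
Qed.

(** Just after [s] the abscissa increases at rate at least [al / 2], on the upper field and on the
    sliding one alike. A zero of [y] would then lie to the right of the fold, against
    [zero_le_fold]. *)
Lemma leaves_at_fold s : 0 < al -> al <= 1 -> y s = 0 -> x s = 1 + al ->
  exists2 d, 0 < d & forall r, s < r -> r <= s + d -> 0 < y r.
Proof.
move=> al0 al1 ys xs.
have [d d0 dP] : exists2 d, 0 < d & forall r, `|r - s| <= d -> 1 / 2 < 0 + 1 * x r + 0 * y r.
  apply: continuous_gt; first exact: (continuous_lincomb sol).
  by rewrite xs; lra.
have [d' d'0 d'P] : exists2 d, 0 < d & forall r, `|r - s| <= d ->
    1 / 2 < (1 - al) + al * x r + (-1) * y r.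
  apply: continuous_gt; first exact: (continuous_lincomb sol).
  have : 0 < al * al by rewrite mulr_gt0.
  by rewrite xs ys; lra.
exists (Num.min d d'); first by rewrite lt_min d0.
move=> r sr; rewrite -lerBlDl le_min => /andP[rd rd'].
rewrite lt_neqAle eq_sym y_ge0 andbT; apply/eqP => yr.
have := zero_le_fold al0 yr.
suff : al / 2 * (r - s) <= x r - x s.
  have : 0 < al / 2 * (r - s) by rewrite mulr_gt0; lra.
  by rewrite xs; lra.
apply: abs_continuous_growth; [lra|by have [] := sol.1 s r|].
apply: ae_imply (nonneg_field al0) => u [vx dx [pos zero]] sur; exists vx => //.
have h1 : 1 / 2 < 0 + 1 * x u + 0 * y u by apply: dP; rewrite ger0_norm; lra.
have h2 : 1 / 2 < (1 - al) + al * x u + (-1) * y u by apply: d'P; rewrite ger0_norm; lra.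
have := y_ge0 u; rewrite le_eqVlt => /predU1P[/esym/zero ->|/pos ->]; last by lra.
have h3 : 0 < x u by lra.
have h4 : al / 2 <= al * x u by rewrite ler_pM2l; lra.
have h5 : 0 <= (1 - al) / (1 + al) * x u by rewrite !mulr_ge0 ?invr_ge0; lra.
by rewrite /slide_rate mulrDl; lra.
Qed.

End Nonnegative.
End Following.

(** * Loops and uniqueness of the sliding orbit *)

Section Uniqueness.
Context {R : realType}.
Implicit Types (al a b c d r s t : R).

Definition arc al a r : R[i] := arc_x al a r +i* arc_y al a r.

(** The base point is the fold [1 + al], the only place of the loop where the solution leaves the
    axis. *)
Definition sliding_loop al t1 : R -> R[i] :=
  concat t1 (arc al (1 + al))
    (fun r => (arc_x al (1 + al) t1 * expR (slide_rate al * r)) +i* 0).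

Definition crossing_loop al a t1 : R -> R[i] :=
  concat t1 (arc al a) (fun r => - arc al a r).

Lemma arc0 al a : arc al a 0 = a +i* 0.
Proof. by rewrite /arc /arc_x /arc_y mulr0 expR0 cos0 sin0; congr (_ +i* _); ring. Qed.

Section Trajectory.
Variables (al : R) (x y : R -> R).
Hypothesis sol : coord_solution al x y.
Variable T : R.
Hypotheses (xT : forall t, x (t + T) = x t) (yT : forall t, y (t + T) = y t).

Let cy := solution_continuous_y sol.

(** Suppose the minimum of [y] over a period is negative. In this region the lower field has
    vertical component at least 1, so [y] was even smaller shortly before. *)
Lemma nonneg_of_region : 0 < al -> 0 < T ->
  (forall t, 0 < y t \/ 0 < x t /\ -1 < y t) -> forall t, 0 <= y t.
Proof.
move=> al0 T0 reg.
have T0' : 0 <= T by lra.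
have [m _ mP] := EVT_min T0' (continuous_subspaceT cy).
have {}mP t : y m <= y t.
  have [r [r0 rT <-]] := periodic_representative T0 yT 0 t.
  by apply: mP; rewrite in_itv /=; lra.
move=> t; apply: le_trans (mP t); rewrite leNgt; apply/negP => ym.
have cNy : continuous (fun r => - y r) by move=> r; apply: cvgN; exact: cy.
have ym' : 0 < - y m by lra.
have [d d0 dP] := continuous_gt cNy ym'.
have : 1 * (m - (m - d)) <= y m - y (m - d).
  apply: (solution_growth_y sol); first lra.
  move=> u vx vy sur [_ neg _].
  have uy : 0 < - y u by apply: dP; rewrite distrC ger0_norm; lra.
  have [|_ ->] := neg; first lra.
  have [|[ux uy1]] := reg u; first lra.
  have : 0 <= al * (y u + 1) by rewrite mulr_ge0; lra.
  by lra.
by have := mP (m - d); lra.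
Qed.

(** The orbit stays in [y >= 0] and meets the axis, necessarily with [0 < x <= 1 + al]. It then
    slides to the fold, and from there its future is determined: spiral, landing, sliding back. *)
Lemma sliding_orbit_unique t1 T2 (s0 s1 : R) : 0 < al -> al <= 1 -> 0 < T ->
  0 < t1 -> (forall r, 0 < r -> r < t1 -> 0 < arc_y al (1 + al) r) ->
  arc_y al (1 + al) t1 = 0 -> 0 < arc_x al (1 + al) t1 ->
  0 < T2 -> arc_x al (1 + al) t1 * expR (slide_rate al * T2) = 1 + al ->
  (forall t, 0 < y t \/ 0 < x t /\ -1 < y t) ->
  x s0 +i* y s0 != x s1 +i* y s1 ->
  range (fun t => x t +i* y t) = sliding_loop al t1 @` `[0, t1 + T2].
Proof.
move=> al0 al1 T0 t10 arcP arct1 x10 T20 x1T2 reg ncst.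
have k0 : 0 < slide_rate al by rewrite /slide_rate ltr_pwDl // divr_ge0; lra.
have y_ge0 := nonneg_of_region al0 T0 reg.
have [s ys] : exists s, y s = 0.
  apply: contrapT => ny; have ypos t : 0 < y t.
    by rewrite lt_neqAle eq_sym y_ge0 andbT; apply/eqP => yt; apply: ny; exists t.
  have cst := periodic_upper_constant sol al0 T0 xT yT ypos.
  by move: ncst; have [-> ->] := cst s0; have [-> ->] := cst s1; rewrite eqxx.
have xs0 : 0 < x s by have [|[]//] := reg s; rewrite ys; lra.
have xs1 := zero_le_fold sol y_ge0 al0 ys.
(* This is the time needed to slide from [x s] to the fold. *)
pose r := ln ((1 + al) / x s) / slide_rate al.
have q1 : 1 <= (1 + al) / x s by rewrite ler_pdivlMr // mul1r.
have r0 : 0 <= r by rewrite divr_ge0 ?ln_ge0 //; lra.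
have xr : x s * expR (slide_rate al * r) = 1 + al.
  rewrite /r mulrC [slide_rate al * _]mulrC divfK ?gt_eqF // lnK ?divfK ?gt_eqF //.
  by rewrite posrE; lra.
have xr' : x s * expR (slide_rate al * r) <= 1 + al by rewrite xr.
have [xsr ysr] := follow_slide sol y_ge0 al0 al1 ys xs0 r0 xr'.
apply: (@range_loop _ _ (fun t => x t +i* y t) _ ((1 + al) +i* 0) T (t1 + T2) (s + r)) => //.
- by move=> t; rewrite xT yT.
- by lra.
- by rewrite xsr ysr xr.
- rewrite /sliding_loop /concat ifF; last by apply/negbTE; rewrite -ltNge; lra.
  by rewrite addrAC subrr add0r x1T2.
clear - al0 al1 t10 arcP arct1 x10 T20 x1T2 k0 y_ge0 sol.
move=> s [] xs ys r r0 rL.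
have [d d0 dP] := leaves_at_fold sol y_ge0 al0 al1 ys xs.
have fol := @follow_upper_arc _ _ _ _ sol s t1 d ys d0 dP.
rewrite xs in fol; have {}fol := fol arcP.
rewrite /sliding_loop /concat; case: ifPn => [rt1|].
  by have [-> ->] := fol r r0 rt1.
rewrite -ltNge => rt1.
have [xt1 yt1] := fol t1 (ltW t10) (lexx _).
rewrite arct1 in yt1; rewrite -xt1 in x10 x1T2.
have rt0 : 0 <= r - t1 by lra.
have [|xE yE] := follow_slide sol y_ge0 al0 al1 yt1 x10 rt0.
  rewrite -x1T2 ler_pM2l // ler_expR ler_pM2l //; lra.
have -> : s + r = s + t1 + (r - t1) by ring.
by rewrite xE yE xt1.
Qed.

End Trajectory.
End Uniqueness.

(** * Half-return map of the upper focus *)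

Section HalfReturn.
Context {R : realType}.
Implicit Types (al a b c d r s t u w : R).

(** Along upper spirals the function [ln |z - p| - al * arg (z - p)] is constant:
    [departure al a] and [arrival al b] are its values at the start [a] and at the
    end [-b] of an arc turning around [p], up to the same additive constant. *)
Definition departure al a : R := ln (1 + (a - 1) ^+ 2) / 2 - al * atan (a - 1).

Definition arrival al b : R :=
  ln (1 + (b + 1) ^+ 2) / 2 + al * atan (b + 1) - 2 * pi * al.

Lemma one_sqr_gt0 c : 0 < 1 + c ^+ 2.
Proof. by rewrite ltr_wpDr ?sqr_ge0. Qed.

Lemma cos_atan_gt0 c : 0 < cos (atan c).
Proof. by apply: cos_gt0_pihalf; rewrite atan_gtNpi2 atan_ltpi2. Qed.

Lemma sin_atan c : sin (atan c) = c * cos (atan c).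
Proof. by rewrite -{2}(atanK c) /tan divfK // gt_eqF // cos_atan_gt0. Qed.

(** A point of the axis at horizontal offset [c] from the focus is at distance [1 / cos (atan c)]
    from it; this links distances with the logarithms in [departure] and [arrival]. *)
Lemma ln_cos_atan c : ln (cos (atan c)) = - (ln (1 + c ^+ 2) / 2).
Proof.
have c0 := one_sqr_gt0 c.
have s0 : 0 < Num.sqrt (1 + c ^+ 2) by rewrite sqrtr_gt0.
rewrite cos_atan lnV ?posrE //; congr (- _).
have -> : ln (1 + c ^+ 2) = ln (Num.sqrt (1 + c ^+ 2)) *+ 2.
  by rewrite -lnXn // sqr_sqrtr // ltW.
by rewrite mulr2n; field.
Qed.

Lemma arrival_lt al b c : 0 < al -> -1 <= b -> b < c -> arrival al b < arrival al c.
Proof.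
move=> al0 b1 bc; rewrite /arrival.
have : ln (1 + (b + 1) ^+ 2) < ln (1 + (c + 1) ^+ 2).
  rewrite ltr_ln ?posrE ?one_sqr_gt0 // ltrD2l.
  by rewrite ltr_pXn2r // ?nnegrE; lra.
have : al * atan (b + 1) < al * atan (c + 1).
  by rewrite ltr_pM2l // lt_atan; lra.
by lra.
Qed.

(** Polar form around the focus: with [u = atan (a - 1)], the starting point has distance
    [1 / cos u] and argument [u - pi / 2]. *)
Lemma arc_yE al a r :
  arc_y al a r = 1 - expR (al * r) * cos (r + atan (a - 1)) / cos (atan (a - 1)).
Proof.
rewrite /arc_y cosD sin_atan; have := cos_atan_gt0 (a - 1).
set c := cos (atan _) => c0; have c1 : c != 0 by rewrite gt_eqF.
by field.
Qed.

Lemma arc_xE al a r :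
  arc_x al a r = 1 + expR (al * r) * sin (r + atan (a - 1)) / cos (atan (a - 1)).
Proof.
rewrite /arc_x sinD sin_atan; have := cos_atan_gt0 (a - 1).
set c := cos (atan _) => c0; have c1 : c != 0 by rewrite gt_eqF.
by field.
Qed.

Lemma cos_le0_middle s : pi / 2 <= s -> s <= 3 * pi / 2 -> cos s <= 0.
Proof.
move=> s1 s2; have -> : s = (s - pi / 2) + pi / 2 by ring.
by rewrite cosDpihalf oppr_le0 sin_ge0_pi //; lra.
Qed.

Lemma sin_le0_upper s : pi <= s -> s <= 2 * pi -> sin s <= 0.
Proof.
move=> s1 s2; have -> : s = (s - pi / 2) + pi / 2 by ring.
rewrite sinDpihalf; apply: cos_le0_middle; lra.
Qed.

Lemma cos_2piB w : cos (2 * pi - w) = cos w.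
Proof.
have -> : 2 * pi - w = - w + pi *+ 2 by rewrite mulr2n; ring.
by rewrite cosD2pi cosN.
Qed.

Lemma sin_2piB w : sin (2 * pi - w) = - sin w.
Proof.
have -> : 2 * pi - w = - w + pi *+ 2 by rewrite mulr2n; ring.
by rewrite sinD2pi sinN.
Qed.

(** The landing equation is [expR (al * t) * cos (t + u) = cos u]. Landing to the left of the focus
    before a full turn gives [t + u = 2 * pi - w] with [0 < w < pi / 2] and end point [1 - tan w];
    taking logarithms gives the equality of levels. *)
Lemma arrival_of_arc al a t : 0 < al -> 1 < a -> 0 < t ->
  (forall r, 0 < r -> r < t -> 0 < arc_y al a r) ->
  arc_y al a t = 0 -> arc_x al a t < 1 ->
  departure al a = arrival al (- arc_x al a t).
Proof.
move=> al0 a1 t0 ypos yt xt.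
have pi0 := @pi_gt0 R.
have u0 : 0 < atan (a - 1) by rewrite -atan0 lt_atan; lra.
have u1 := atan_ltpi2 (a - 1).
have cu := cos_atan_gt0 (a - 1).
move: yt xt; rewrite arc_yE arc_xE; set u := atan (a - 1) in u0 u1 cu *.
have E0 := expR_gt0 (al * t).
move=> yt xt.
have ct : expR (al * t) * cos (t + u) = cos u.
  apply: (mulIf (invr_neq0 (lt0r_neq0 cu))).
  by rewrite divff ?lt0r_neq0 //; lra.
have ct0 : 0 < cos (t + u).
  by rewrite -(pmulr_rgt0 _ E0) ct.
have st0 : sin (t + u) < 0.
  rewrite ltNge; apply/negP => s0.
  have : 0 <= expR (al * t) * sin (t + u) / cos u by rewrite !mulr_ge0 ?invr_ge0 // ltW.
  by lra.
(* At time [2 * pi - u] the spiral is straight below the focus at distance greater than 1, hence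
   under the axis. *)
have tu : t + u < 2 * pi.
  rewrite ltNge; apply/negP => tu.
  have r0 : 0 < 2 * pi - u by lra.
  have e1 : 1 < expR (al * (2 * pi - u)) by rewrite expR_gt1 mulr_gt0.
  have : 0 <= arc_y al a (2 * pi - u).
    have [rt|rt] := ltP (2 * pi - u) t; first exact/ltW/ypos.
    have -> : 2 * pi - u = t by lra.
    by rewrite arc_yE -/u yt.
  rewrite arc_yE -/u subrK.
  have -> : cos (2 * pi) = 1 :> R by rewrite -[2 * pi]subr0 cos_2piB cos0.
  rewrite mulr1 subr_ge0 ler_pdivrMr // mul1r => h.
  by have := cos_le1 u; lra.
pose w := 2 * pi - (t + u).
have tuE : t + u = 2 * pi - w by rewrite /w; ring.
move: ct0 st0 ct; rewrite tuE cos_2piB sin_2piB => cw sw ct.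
have w1 : w < pi / 2.
  rewrite ltNge; apply/negP => w1.
  have [w2|w2] := leP w (3 * pi / 2); first by have := cos_le0_middle w1 w2; lra.
  by have := @sin_le0_upper w; rewrite /w in w2 *; lra.
have -> : - (1 + expR (al * t) * - sin w / cos u) = tan w - 1.
  by rewrite -ct /tan; field; rewrite !gt_eqF.
rewrite /departure /arrival subrK tanK; last by rewrite in_itv /= w1; rewrite /w; lra.
have lnu : ln (cos u) = al * t + ln (cos w).
  by rewrite -ct lnM ?posrE // expRK.
have lnw : ln (cos w) = - (ln (1 + tan w ^+ 2) / 2).
  by rewrite -ln_cos_atan tanK // in_itv /= w1; rewrite /w; lra.
have := ln_cos_atan (a - 1); rewrite -/u lnu.
have -> : t = 2 * pi - w - u by rewrite /w; ring.
by lra.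
Qed.

(** The duration is [t = 2 * pi - w - u], and equal levels mean [expR (al * t) * cos w = cos u]. The
    arc is above the axis when [expR (al * r) * cos (r + u) < cos u]: clear if the cosine is not
    positive; in the last quarter turn both factors are below their values at [t]; the first quarter
    is the case using [1 + al <= a]. *)
Lemma arc_of_arrival al a b : 0 < al -> 1 + al <= a -> -1 <= b ->
  departure al a = arrival al b ->
  exists t, [/\ 0 < t, forall r, 0 < r -> r < t -> 0 < arc_y al a r,
    arc_y al a t = 0 & arc_x al a t = - b].
Proof.
move=> al0 a1 b1 lev.
have pi0 := @pi_gt0 R.
pose u := atan (a - 1); pose w := atan (b + 1).
have u0 : 0 < u by rewrite /u -atan0 lt_atan; lra.
have w0 : 0 <= w by rewrite /w -atan0 le_atan; lra.
have u1 : u < pi / 2 := atan_ltpi2 _.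
have w1 : w < pi / 2 := atan_ltpi2 _.
have cu : 0 < cos u := cos_atan_gt0 _.
have cw : 0 < cos w := cos_atan_gt0 _.
pose t := 2 * pi - w - u.
have t0 : 0 < t by rewrite /t; lra.
have tu : t + u = 2 * pi - w by rewrite /t; ring.
have ct : expR (al * t) * cos w = cos u.
  have -> : cos u = expR (ln (cos u)) by rewrite lnK ?posrE.
  have {1}-> : cos w = expR (ln (cos w)) by rewrite lnK ?posrE.
  rewrite -expRD; congr expR; rewrite !ln_cos_atan /t.
  by move: lev; rewrite /departure /arrival -/u -/w; lra.
exists t; split => //.
- move=> r r0 rt; rewrite arc_yE -/u subr_gt0 ltr_pdivrMr // mul1r.
  have E0 := expR_gt0 (al * r).
  have [mid|] := leP (cos (r + u)) 0.
    by apply: le_lt_trans cu; rewrite pmulr_rle0.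
  have [s1 _|s1] := ltP (r + u) (pi / 2); last first.
    have [s2|s2] := leP (r + u) (3 * pi / 2).
      by have := cos_le0_middle s1 s2; lra.
    have -> : r + u = 2 * pi - (2 * pi - (r + u)) by ring.
    rewrite cos_2piB => q0; rewrite -ct; apply: ltr_pM => //; try exact: ltW.
      by rewrite ltr_expR ltr_pM2l.
    by rewrite ltr_cos ?in_itv /=; rewrite /t in rt *; lra.
  (* This function equals [cos u] at [u] and decreases afterwards, since
     [tan s > tan u = a - 1 >= al] for [s] between [u] and [pi / 2]. *)
  pose f s := expR (al * (s - u)) * cos s.
  pose df s := expR (al * (s - u)) * (al * cos s - sin s).
  have dE s : is_derive (s : R^o) 1 (f : R^o -> R^o) (df s).
    by apply: (is_derive_eq _); rewrite /GRing.scale /= /df; ring.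
  have ur : u < r + u by lra.
  have [|c] := MVT ur (fun s _ => dE s).
    by apply: continuous_subspaceT => s; exact: is_derive_continuous (dE s).
  rewrite in_itv /= => /andP[uc cr].
  rewrite /f subrr mulr0 expR0 mul1r addrK => fE.
  suff : df c < 0 by move=> dfc; have : df c * r < 0 by [rewrite nmulr_rlt0]; lra.
  rewrite /df nmulr_llt0 ?expR_gt0 // subr_lt0.
  have cc : 0 < cos c by apply: cos_gt0_pihalf; lra.
  have : 0 < sin (c - u) by apply: sin_gt0_pihalf; lra.
  rewrite sinB sin_atan -/u.
  have -> : sin c * cos u - cos c * ((a - 1) * cos u) =
    (sin c - (a - 1) * cos c) * cos u by ring.
  rewrite pmulr_lgt0 //.
  have : al * cos c <= (a - 1) * cos c by rewrite ler_pM2r //; lra.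
  by lra.
- by rewrite arc_yE -/u tu cos_2piB ct divff ?subrr // gt_eqF.
- rewrite arc_xE -/u tu sin_2piB sin_atan -/w.
  have -> : expR (al * t) * - ((b + 1) * cos w) =
    - ((b + 1) * (expR (al * t) * cos w)) by ring.
  by rewrite ct mulNr mulfK ?gt_eqF //; ring.
Qed.

Definition displacement al a := departure al a - arrival al a.

Lemma is_derive_displacement al a : is_derive (a : R^o) 1 (displacement al : R^o -> R^o)
  (((4 - 2 * (1 + al)) * a ^+ 2 - 4 * (1 + al)) / ((1 + (a - 1) ^+ 2) * (1 + (a + 1) ^+ 2))).
Proof.
have p1 := one_sqr_gt0 (a - 1); have p2 := one_sqr_gt0 (a + 1).
have d1 := is_derive1_ln p1; have d2 := is_derive1_ln p2.
apply: (is_derive_eq _); rewrite /GRing.scale /=.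
field; apply/andP; split; rewrite gt_eqF //.
Qed.

(** Where [a ^ 2 >= 4], the numerator of the derivative is at least [4 - 12 * al], which is
    positive. *)
Lemma displacement_lt al a b : 0 < al -> al <= 1 / 100 -> 2 <= a -> a < b ->
  displacement al a < displacement al b.
Proof.
move=> al0 al1 a2 ab.
have [|c] := MVT ab (fun s _ => is_derive_displacement al s).
  apply: continuous_subspaceT => s.
  exact: is_derive_continuous (is_derive_displacement al s).
rewrite in_itv /= => /andP[ac cb] dE; rewrite -subr_gt0 dE mulr_gt0 ?subr_gt0 //.
rewrite divr_gt0 ?mulr_gt0 ?one_sqr_gt0 // subr_gt0.
have c4 : 4 <= c ^+ 2 by rewrite expr2; nra.
have : 0 <= (2 - 2 * al) * (c ^+ 2 - 4) by rewrite mulr_ge0; lra.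
by lra.
Qed.

Lemma displacement_root al : 0 < al -> al <= 1 / 100 -> exists2 a, 2 < a &
  [/\ displacement al a = 0, forall b, a < b -> 0 < displacement al b &
      forall b, 2 <= b -> b < a -> displacement al b < 0].
Proof.
move=> al0 al1.
have pi2 := @pi_ge2 R; have pi4 : pi < 4 :> R by have := @pihalf_lt2 R; lra.
have at2 c : atan c <= 2 by have := atan_ltpi2 c; lra.
(* The logarithms contribute at most [- 2 / 5], while [2 * pi * al] is at most [2 / 25]. *)
have D2 : displacement al 2 < 0.
  have l1 : ln (1 + (2 - 1) ^+ 2) / 2 - ln (1 + (2 + 1) ^+ 2) / 2 <= - (2 / 5) :> R.
    have -> : 1 + (2 - 1) ^+ 2 = 2 :> R by ring.
    have -> : 1 + (2 + 1) ^+ 2 = 10 :> R by ring.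
    have : ln (2 / 10) <= - (4 / 5) :> R.
      have -> : 2 / 10 = 1 + - (4 / 5) :> R by field.
      by apply: le_ln1Dx; lra.
    by rewrite ln_div ?posrE //; lra.
  have a1 : 0 <= atan (2 - 1) :> R by rewrite -atan0 le_atan; lra.
  have a2 : 0 <= atan (2 + 1) :> R by rewrite -atan0 le_atan; lra.
  have h1 : 0 <= al * atan (2 - 1) by rewrite mulr_ge0; lra.
  have h2 : 0 <= al * atan (2 + 1) by rewrite mulr_ge0; lra.
  have h3 : al * pi <= 1 / 100 * 4 by apply: ler_pM; lra.
  by rewrite /displacement /departure /arrival; lra.
(* At distance [3 / al] the logarithms lose less than [2 * al], while the angular terms leave a gain
   of at least [pi * al >= 2 * al]. *)
pose k := 3 / al; have ka : al * k = 3 by rewrite /k mulrC divfK // gt_eqF.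
have k1 : 300 <= k by rewrite /k ler_pdivlMr //; lra.
have D3 : 0 < displacement al (1 + k).
  have p1 := one_sqr_gt0 k; have p2 := one_sqr_gt0 (k + 2).
  have l1 : ln ((1 + (k + 2) ^+ 2) / (1 + k ^+ 2)) <= 4 * (k + 1) / (1 + k ^+ 2).
    have -> : (1 + (k + 2) ^+ 2) / (1 + k ^+ 2) = 1 + 4 * (k + 1) / (1 + k ^+ 2).
      by field; rewrite gt_eqF.
    have : 0 <= 4 * (k + 1) / (1 + k ^+ 2) by rewrite divr_ge0 ?(ltW p1) //; lra.
    by move=> ?; apply: le_ln1Dx; lra.
  rewrite ln_div ?posrE // in l1.
  have l2 : 4 * (k + 1) / (1 + k ^+ 2) < 4 * al.
    rewrite ltr_pdivrMr //.
    have -> : 4 * al * (1 + k ^+ 2) = 4 * (al + k * (al * k)) by ring.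
    by rewrite ka; lra.
  have l3 : al * (atan k + atan (k + 2)) <= al * pi.
    by rewrite ler_pM2l //; have := atan_ltpi2 k; have := atan_ltpi2 (k + 2); lra.
  have l4 : al * 2 <= al * pi by rewrite ler_pM2l.
  rewrite /displacement /departure /arrival.
  have -> : 1 + k - 1 = k by ring.
  have -> : 1 + k + 1 = k + 2 by ring.
  by lra.
have k2 : 2 <= 1 + k by lra.
have [||a] := @IVT _ (displacement al) 2 (1 + k) 0 k2.
- apply: continuous_subspaceT => s.
  exact: is_derive_continuous (is_derive_displacement al s).
- by rewrite ge_min le_max (ltW D2) (ltW D3) orbT.
rewrite in_itv /= => /andP[a2 _] Da.
have {}a2 : 2 < a.
  by rewrite lt_neqAle a2 andbT; apply/eqP => a2'; rewrite -a2' in Da; lra.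
exists a => //; split=> // b; rewrite -Da.
  by apply: displacement_lt => //; lra.
by move=> b2 ba; apply: displacement_lt.
Qed.

(** The level of the fold lies strictly between the arrival levels at [-1] and [0]. By the
    intermediate value theorem the spiral leaving the fold lands between 0 and 1, from where sliding
    leads back to the fold. *)
Lemma landing_on_sliding al : 0 < al -> al <= 1 / 100 ->
  exists2 b, -1 < b /\ b < 0 & departure al (1 + al) = arrival al b.
Proof.
move=> al0 al1.
have pi2 := @pi_ge2 R; have pi4 : pi < 4 :> R by have := @pihalf_lt2 R; lra.
have [m [m0 m1]] : exists m,
    [/\ arrival al (-1) < m, m < arrival al 0 & m = departure al (1 + al)].
  exists (departure al (1 + al)); split => //; rewrite /departure /arrival.
    have -> : 1 + al - 1 = al by ring.
    rewrite addNr expr0n /= addr0 ln1 atan0.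
    have : 0 <= ln (1 + al ^+ 2) by rewrite ln_ge0 // lerDl sqr_ge0.
    have : al * atan al <= al * (pi / 2) by rewrite ler_pM2l // ltW // atan_ltpi2.
    have : 0 < al * pi by rewrite mulr_gt0; lra.
    by lra.
  have -> : 1 + al - 1 = al by ring.
  rewrite add0r expr1n.
  have : ln (1 + al ^+ 2) <= al ^+ 2 by apply: le_ln1Dx; have := sqr_ge0 al; lra.
  have : al ^+ 2 <= 1 / 100 * (1 / 100) by rewrite expr2; apply: ler_pM; lra.
  have : 1 / 2 <= ln (1 + 1) :> R.
    have : ln (1 / 2) <= - (1 / 2) :> R.
      have h : 1 / 2 = 1 + - (1 / 2) :> R by field.
      by rewrite [X in ln X]h; apply: le_ln1Dx; lra.
    by rewrite ln_div ?posrE // ln1; lra.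
  have atan_ge0 c : 0 <= c -> 0 <= atan c by move=> c0; rewrite -atan0 le_atan.
  have : 0 <= al * atan al by rewrite mulr_ge0 ?atan_ge0 // ltW.
  have : 0 <= al * atan 1 by rewrite mulr_ge0 ?atan_ge0 // ltW.
  have : al * pi <= 1 / 100 * 4 by apply: ler_pM; lra.
  by lra.
move=> mE.
have m1' : -1 <= 0 :> R by lra.
have [||b] := @IVT _ (arrival al) (-1) 0 m m1'.
- apply: continuous_subspaceT => b.
  have p := one_sqr_gt0 (b + 1); have d := is_derive1_ln p.
  apply: (@is_derive_continuous _ _ _ ((b + 1) / (1 + (b + 1) ^+ 2) + al / (1 + (b + 1) ^+ 2))).
  by apply: (is_derive_eq _); rewrite /GRing.scale /=; field; rewrite gt_eqF.
- by rewrite ge_min le_max (ltW m0) (ltW m1) orbT.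
rewrite in_itv /= => /andP[b1 b0] bE.
exists b; last by rewrite -mE bE.
split.
  by rewrite lt_neqAle b1 andbT; apply/eqP => b1'; rewrite -bE -b1' ltxx in m0.
by rewrite lt_neqAle b0 andbT; apply/eqP => b0'; rewrite -bE b0' ltxx in m1.
Qed.

End HalfReturn.

(** * Crossing orbits *)

Section CrossingUniqueness.
Context {R : realType}.
Implicit Types (x y : R -> R) (al a b c d r s t : R).

(** By periodicity the upper arc starting at [x s] returns to the axis. It cannot return with
    [x > 2], where crossings go upward, so it lands with [x < -2] and the levels agree. *)
Lemma crossing_next al x y T s : coord_solution al x y ->
  0 < al -> al <= 1 / 100 -> 0 < T ->
  (forall t, y (t + T) = y t) -> (forall t, y t = 0 -> 2 < `|x t|) ->
  y s = 0 -> 2 < x s ->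
  exists2 s', y s' = 0 & 2 < - x s' /\ departure al (x s) = arrival al (- x s').
Proof.
move=> sol al0 al1 T0 yT far ys xs.
have cy := solution_continuous_y sol.
have xs' : 1 + al < x s by lra.
have [d d0 [dP _]] := crossing_upward sol al0 ys xs'.
(* A time with [y a > 0] that precedes the zero [s + T], as needed for [first_zero]. *)
pose a := s + Num.min d (T / 2).
have sa : s < a by rewrite ltrDl lt_min d0; lra.
have ad : a <= s + d by rewrite lerD2l ge_min lexx.
have aT : a <= s + T.
  have : a <= s + T / 2 by rewrite lerD2l ge_min lexx orbT.
  by lra.
have yTs : y (s + T) <= 0 by rewrite yT ys.
have [s' [as' _ ys' s'P]] := first_zero cy aT (dP a sa ad) yTs.
have ypos v : s < v -> v < s' -> 0 < y v.
  by move=> sv vs'; have [va|av] := leP v a; [apply: dP|apply: s'P]; lra.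
have arcs v : s <= v -> v <= s' ->
    x v = arc_x al (x s) (v - s) /\ y v = arc_y al (x s) (v - s).
  by move=> sv vs'; apply: (upper_arc sol) => // r sr; apply: ypos; lra.
have xs'2 : 2 < - x s'.
  have := far _ ys'; rewrite ltr_normr => /orP[xp|//].
  have xp' : 1 + al < x s' by lra.
  have [e e0 [_ eP]] := crossing_upward sol al0 ys' xp'.
  pose v := Num.max a (s' - e).
  have av : a <= v by rewrite le_max lexx.
  have ev : s' - e <= v by rewrite le_max lexx orbT.
  have vs' : v < s' by rewrite gt_max as'; lra.
  have : 0 < y v by apply: ypos; lra.
  by have := eP v ev vs'; lra.
have [xE yE] : x s' = arc_x al (x s) (s' - s) /\ y s' = arc_y al (x s) (s' - s).
  by apply: arcs; lra.
exists s' => //; split => //; rewrite xE; apply: arrival_of_arc => //.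
- by lra.
- by lra.
- move=> r r0 rs'; have [||_] := arcs (s + r); [lra|lra|].
  rewrite addrAC subrr add0r => <-; apply: ypos; lra.
- by rewrite -yE.
- by rewrite -xE; lra.
Qed.

(** Crossings on the negative side reduce to the positive side by [z |-> -z]. *)
Lemma crossing_next_abs al x y T s : coord_solution al x y ->
  0 < al -> al <= 1 / 100 -> 0 < T ->
  (forall t, y (t + T) = y t) -> (forall t, y t = 0 -> 2 < `|x t|) -> y s = 0 ->
  exists2 s', y s' = 0 &
    [/\ departure al `|x s| = arrival al `|x s'|, x s < 0 -> 0 < x s' & 0 < x s -> x s' < 0].
Proof.
move=> sol al0 al1 T0 yT far ys; have := far s ys; rewrite ltr_normr => /orP[xs|xs].
  have [s' ys' [xs' lev]] := crossing_next sol al0 al1 T0 yT far ys xs.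
  exists s' => //; rewrite gtr0_norm; last lra.
  by rewrite ltr0_norm; [split=> //; lra|lra].
have [|t yt|||s' ys' [xs' lev]] := crossing_next (coord_solution_opp sol) al0 al1 T0 (s := s).
- by move=> t; rewrite yT.
- by rewrite normrN; apply: far; lra.
- by rewrite ys oppr0.
- exact: xs.
rewrite opprK in lev xs'.
exists s'; first lra.
rewrite ltr0_norm; last lra.
by rewrite gtr0_norm; [split=> //; lra|lra].
Qed.

(** The zeros of [y] within one period form a nonempty compact set and represent all zeros. *)
Lemma extremal_zero al x y T : coord_solution al x y -> 0 < T ->
  (forall t, x (t + T) = x t) -> (forall t, y (t + T) = y t) ->
  (exists s, y s = 0) ->
  (exists2 m, y m = 0 & forall t, y t = 0 -> `|x t| <= `|x m|) /\
  (exists2 m, y m = 0 & forall t, y t = 0 -> `|x m| <= `|x t|).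
Proof.
move=> sol T0 xT yT [s ys].
have cx := solution_continuous_x sol; have cy := solution_continuous_y sol.
pose Z : set R := [set t | t \in `[0, T] /\ y t = 0].
have compZ : compact Z.
  apply: (@subclosed_compact _ _ `[0, T]%classic); last by move=> t [].
    have -> : Z = `[0, T]%classic `&` y @^-1` [set 0] by apply/seteqP; split.
    apply: closedI; first exact: interval_closed.
    by apply: closed_comp => [t _|]; [exact: cy|exact: closed_eq].
  exact: segment_compact.
have rep t : y t = 0 -> exists2 r, Z r & x r = x t.
  have pT u : (fun v => (x v, y v)) (u + T) = (x u, y u) by rewrite xT yT.
  have [r [r0 rT [xr yr]]] := periodic_representative T0 pT 0 t.
  move=> yt; exists r => //; split; last by rewrite yr.
  by rewrite in_itv /= r0; lra.
have Z0 : Z !=set0 by have [r Zr _] := rep s ys; exists r.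
have cn : {within Z, continuous (fun t => `|x t|)}.
  apply: continuous_subspaceT => t.
  exact: (@continuous_comp _ _ _ x Num.norm t (cx t) (@norm_continuous _ _ _)).
split.
  have [m /set_mem[_ ym] mP] := compact_EVT_max Z0 compZ cn.
  exists m => // t yt; have [r Zr <-] := rep t yt.
  by apply: mP; apply/mem_set.
have [m /set_mem[_ ym] mP] := compact_EVT_min Z0 compZ cn.
exists m => // t yt; have [r Zr <-] := rep t yt.
by apply: mP; apply/mem_set.
Qed.

(** An orbit that avoids the axis stays on one side of it, and a periodic one is then reduced to a
    focus. *)
Lemma zero_exists al x y T s0 s1 : coord_solution al x y -> 0 < al -> 0 < T ->
  (forall t, x (t + T) = x t) -> (forall t, y (t + T) = y t) ->
  x s0 +i* y s0 != x s1 +i* y s1 -> exists s, y s = 0.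
Proof.
move=> sol al0 T0 xT yT ncst; apply: contrapT => ny.
have cy := solution_continuous_y sol.
have ivt a b : 0 < y a -> y b < 0 -> False.
  move=> ya yb; have [r [ar rT yr]] := periodic_representative T0 yT a b.
  have yr0 : y r <= 0 by lra.
  by have [t [_ _ yt _]] := first_zero cy ar ya yr0; apply: ny; exists t.
have yn0 t : y t != 0 by apply/eqP => yt; apply: ny; exists t.
have [y0|y0|y0] := ltgtP 0 (y 0); last by have := yn0 0; rewrite -y0 eqxx.
  have ypos t : 0 < y t.
    have [//|yt|yt] := ltgtP 0 (y t); first by case: (ivt _ _ y0 yt).
    by have := yn0 t; rewrite -yt eqxx.
  have cst := periodic_upper_constant sol al0 T0 xT yT ypos.
  by move: ncst; have [-> ->] := cst s0; have [-> ->] := cst s1; rewrite eqxx.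
have ypos t : 0 < - y t.
  rewrite oppr_gt0.
  by have [yt|//|yt] := ltgtP 0 (y t); [case: (ivt _ _ yt y0)|have := yn0 t; rewrite -yt eqxx].
have xTn t : - x (t + T) = - x t by rewrite xT.
have yTn t : - y (t + T) = - y t by rewrite yT.
have cst := periodic_upper_constant (coord_solution_opp sol) al0 T0 xTn yTn ypos.
have {}cst t : x t = -1 /\ y t = -1 by have [? ?] := cst t; split; lra.
by move: ncst; have [-> ->] := cst s0; have [-> ->] := cst s1; rewrite eqxx.
Qed.

End CrossingUniqueness.

(** * Uniqueness of the crossing orbit *)

Section CrossingOrbit.
Context {R : realType}.
Implicit Types (x y : R -> R) (al a b c d r s t : R).

(** If the outermost crossing were beyond [a], the next one would be still further out; if the
    innermost were closer than [a], the next one would be still closer. Hence all crossings are at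
    [a] or [-a], and the orbit follows the loop. *)
Lemma crossing_orbit_unique al x y T a t1 s0 s1 : coord_solution al x y ->
  0 < al -> al <= 1 / 100 -> 0 < T ->
  (forall t, x (t + T) = x t) -> (forall t, y (t + T) = y t) ->
  2 < a -> (forall b, a < b -> 0 < displacement al b) ->
  (forall b, 2 <= b -> b < a -> displacement al b < 0) ->
  0 < t1 -> (forall r, 0 < r -> r < t1 -> 0 < arc_y al a r) ->
  arc_y al a t1 = 0 -> arc_x al a t1 = - a ->
  (forall t, y t = 0 -> 2 < `|x t|) ->
  x s0 +i* y s0 != x s1 +i* y s1 ->
  range (fun t => x t +i* y t) = crossing_loop al a t1 @` `[0, t1 + t1].
Proof.
move=> sol al0 al1 T0 xT yT a2 outer inner t10 arcP yt1 xt1 far ncst.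
have ex0 := zero_exists sol al0 T0 xT yT ncst.
have next t := crossing_next_abs (s := t) sol al0 al1 T0 yT far.
have [[m ym mP] [n yn nP]] := extremal_zero sol T0 xT yT ex0.
have arr b c : -1 <= b -> -1 <= c -> arrival al b < arrival al c -> b < c.
  move=> b1 c1; apply: contraTT; rewrite -!leNgt le_eqVlt => /predU1P[->//|cb].
  exact/ltW/arrival_lt.
have norm_ge b : -1 <= `|b| by have := normr_ge0 b; lra.
have upper : `|x m| <= a.
  rewrite leNgt; apply/negP => /outer; rewrite subr_gt0.
  have [s' ys' [-> _ _]] := next m ym => /arr; rewrite !norm_ge => /(_ isT isT).
  by have := mP s' ys'; lra.
have lower : a <= `|x n|.
  rewrite leNgt; apply/negP => /inner; rewrite subr_lt0 => /(_ (ltW (far n yn))).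
  have [s' ys' [-> _ _]] := next n yn => /arr; rewrite !norm_ge => /(_ isT isT).
  by have := nP s' ys'; lra.
have abs_zero t : y t = 0 -> `|x t| = a.
  by move=> yt; have := mP t yt; have := nP t yt; lra.
have [s ys xs] : exists2 s, y s = 0 & x s = a.
  have := abs_zero m ym; have [xm|xm|xm] := ltgtP 0 (x m).
  - by rewrite gtr0_norm // => <-; exists m.
  - move=> _; have [s ys [_ /(_ xm) xs _]] := next m ym.
    by exists s => //; rewrite -(abs_zero s ys) gtr0_norm.
  - by rewrite -xm normr0; lra.
have a1 : 1 + al < a by lra.
apply: (@range_loop _ _ (fun t => x t +i* y t) _ (a +i* 0) T (t1 + t1) s) => //.
- by move=> t; rewrite xT yT.
- by lra.
- by rewrite ys xs.
- rewrite /crossing_loop /concat ifF; last by apply/negbTE; rewrite -ltNge; lra.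
  by rewrite addrK /arc yt1 xt1 /GRing.opp /= opprK oppr0.
move=> {ys xs}s [] xs ys r r0 rL.
have xs' : 1 + al < x s by rewrite xs.
have [d d0 [dP _]] := crossing_upward sol al0 ys xs'.
have fol := @follow_upper_arc _ _ _ _ sol s t1 d ys d0 dP.
rewrite xs in fol; have {}fol := fol arcP.
rewrite /crossing_loop /concat; case: ifPn => [rt1|].
  by have [-> ->] := fol r r0 rt1.
rewrite -ltNge => rt1.
have [xst yst] := fol t1 (ltW t10) (lexx _); rewrite xt1 in xst; rewrite yt1 in yst.
(* The lower half of the loop is the upper arc of the opposite solution, which is at [a] at time
   [s + t1]. *)
have solN := coord_solution_opp sol.
have yst' : - y (s + t1) = 0 by rewrite yst oppr0.
have xst' : - x (s + t1) = a by rewrite xst opprK.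
have xst2 : 1 + al < - x (s + t1) by rewrite xst'.
have [d' d'0 [d'P _]] := crossing_upward solN al0 yst' xst2.
have fol' := @follow_upper_arc _ _ _ _ solN (s + t1) t1 d' yst' d'0 d'P.
rewrite xst' in fol'; have {fol'}[||xE yE] := fol' arcP (r - t1); [lra|lra|].
have sr : s + t1 + (r - t1) = s + r by ring.
rewrite sr in xE yE.
by rewrite /arc -xE -yE /GRing.opp /= !opprK.
Qed.

End CrossingOrbit.

(** * Closed orbits glued from two arcs *)

Section Gluing.
Context {R : realType}.
Implicit Types (f g df dg : R -> R) (a b c d r s t : R).
Local Notation mu := (@lebesgue_measure R).

(** The representative of [t] modulo [L] in [[0, L[]. *)
Definition phase (L t : R) : R := t - (Num.floor (t / L))%:~R * L.

Lemma phase_itv L t : 0 < L -> 0 <= phase L t < L.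
Proof.
move=> L0; have /andP[] := floor_itv (t / L).
by rewrite ler_pdivlMr // ltr_pdivrMr // intrD mulrDl mul1r /phase; lra.
Qed.

Lemma phaseE L (m : int) t : 0 < L -> m%:~R * L <= t -> t < m%:~R * L + L ->
  phase L t = t - m%:~R * L.
Proof.
move=> L0 mt tm; rewrite /phase (@floor_def _ _ m) //.
by rewrite ler_pdivlMr // ltr_pdivrMr // intrD mulrDl mul1r mt.
Qed.

Lemma phase_periodic L t : 0 < L -> phase L (t + L) = phase L t.
Proof.
move=> L0; have := phase_itv t L0; rewrite {1 2}/phase; set m := Num.floor _ => h.
rewrite (@phaseE _ (m + 1)) // ?intrD ?mulrDl ?mul1r; [rewrite /phase -/m; ring|lra|lra].
Qed.

Lemma phase_id L t : 0 < L -> 0 <= t -> t < L -> phase L t = t.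
Proof. by move=> L0 t0 tL; rewrite (@phaseE _ 0) ?mul0r ?subr0 ?add0r. Qed.

Lemma range_phase (A : Type) (h : R -> A) L : 0 < L -> h L = h 0 ->
  range (fun t => h (phase L t)) = h @` `[0, L].
Proof.
move=> L0 hL; apply/seteqP; split => z [t].
  move=> _ <-; exists (phase L t) => //.
  by have := phase_itv t L0; rewrite /= in_itv /=; lra.
rewrite /= in_itv /= => /andP[t0]; rewrite le_eqVlt => /predU1P[->|tL] <-.
  by exists 0 => //; rewrite phase_id.
by exists t => //; rewrite phase_id.
Qed.

Section TwoPieces.
Variables (f g df dg : R -> R) (t1 t2 : R).
Hypotheses (fdf : forall t, is_derive (t : R^o) 1 (f : R^o -> R^o) (df t))
           (gdg : forall t, is_derive (t : R^o) 1 (g : R^o -> R^o) (dg t)).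
Hypotheses (cdf : continuous df) (cdg : continuous dg).
Hypotheses (fg : f t1 = g 0) (gf : g t2 = f 0).

Let glued t := concat t1 f g (phase (t1 + t2) t).

(** Each piece is Lipschitz, and the values agree at the junction and at the two ends of a
    period. *)
Lemma glued_lipschitz : 0 < t1 -> 0 < t2 -> exists K : R, forall s t, s <= t ->
  `|glued t - glued s| <= K * (t - s).
Proof.
move=> t10 t20; have L0 : 0 < t1 + t2 by lra.
have [K1 K10 K1P] := C1_lipschitz 0 t1 fdf cdf.
have [K2 K20 K2P] := C1_lipschitz 0 t2 gdg cdg.
pose K := Num.max K1 K2; exists K.
have K1K : K1 <= K by rewrite le_max lexx.
have K2K : K2 <= K by rewrite le_max lexx orbT.
have K0 : 0 <= K by apply: le_trans K1K.
have piece s t : 0 <= s -> s <= t -> t <= t1 + t2 ->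
    `|concat t1 f g t - concat t1 f g s| <= K * (t - s).
  move=> s0 st tL; rewrite /concat; have [tt1|tt1] := leP t t1.
    rewrite (le_trans st tt1); apply: le_trans (K1P _ _ s0 st tt1) _.
    by rewrite ler_wpM2r //; lra.
  have [st1|st1] := leP s t1; last first.
    apply: le_trans (K2P (s - t1) (t - t1) _ _ _) _; [lra|lra|lra|].
    have -> : t - t1 - (s - t1) = t - s by ring.
    by rewrite ler_wpM2r //; lra.
  have -> : g (t - t1) - f s = (g (t - t1) - g 0) + (f t1 - f s) by rewrite fg; ring.
  apply: le_trans (ler_normD _ _) _.
  have h1 : `|g (t - t1) - g 0| <= K2 * (t - t1 - 0) by apply: K2P; lra.
  have h2 := K1P s t1 s0 st1 (lexx _).
  have h3 : K2 * (t - t1 - 0) <= K * (t - t1) by rewrite subr0 ler_wpM2r //; lra.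
  have h4 : K1 * (t1 - s) <= K * (t1 - s) by rewrite ler_wpM2r //; lra.
  by lra.
have ends : concat t1 f g (t1 + t2) = concat t1 f g 0.
  have c1 : (t1 + t2 <= t1) = false by apply/negbTE; rewrite -ltNge; lra.
  have c2 : 0 <= t1 by lra.
  have -> : concat t1 f g (t1 + t2) = g (t1 + t2 - t1) by rewrite /concat c1.
  by rewrite /concat c2 addrAC subrr add0r gf.
move=> s t st; rewrite /glued.
have s1 := phase_itv s L0; have t1' := phase_itv t L0.
move: s1 t1'; rewrite /phase; set m := Num.floor (s / _); set n := Num.floor (t / _).
move=> p1 q1; have mn' : m <= n.
  by rewrite floor_ge_int; apply: le_trans (ge_floor _) _; rewrite ler_pM2r ?invr_gt0.
move: p1 q1; clearbody m n; set p := s - m%:~R * _; set q := t - n%:~R * _ => p1 q1.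
have [mn|mn] := eqVneq m n.
  have e : q - p = t - s by rewrite /p /q mn; ring.
  by rewrite -e; apply: piece; lra.
have {mn mn'}mn : m + 1 <= n by rewrite lezD1 lt_neqAle mn.
have mnL : (m + 1)%:~R * (t1 + t2) <= n%:~R * (t1 + t2).
  by rewrite ler_pM2r // ler_int.
rewrite intrD mulrDl mul1r in mnL.
(* Full laps between the two times are skipped: the values at the start and at the end of a lap
   coincide. *)
have -> : concat t1 f g q - concat t1 f g p =
  (concat t1 f g q - concat t1 f g 0) + (concat t1 f g (t1 + t2) - concat t1 f g p).
  by rewrite ends; ring.
apply: le_trans (ler_normD _ _) _.
have h1 : `|concat t1 f g q - concat t1 f g 0| <= K * (q - 0) by apply: piece; lra.
have h2 : `|concat t1 f g (t1 + t2) - concat t1 f g p| <= K * (t1 + t2 - p).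
  by apply: piece; lra.
have h3 : K * (q - 0 + (t1 + t2 - p)) <= K * (t - s).
  by rewrite ler_wpM2l // /q /p; lra.
by lra.
Qed.

Lemma glued_abs_continuous a b : 0 < t1 -> 0 < t2 -> abs_continuous a b glued.
Proof.
move=> t10 t20; have [K KP] := glued_lipschitz t10 t20.
by apply: lipschitz_abs_continuous => s t _ st _; exact: KP st.
Qed.

Lemma glued_is_derive t : 0 < t1 -> 0 < t2 ->
  phase (t1 + t2) t != 0 -> phase (t1 + t2) t != t1 ->
  is_derive (t : R^o) 1 (glued : R^o -> R^o)
    (concat t1 df dg (phase (t1 + t2) t)).
Proof.
move=> t10 t20 p0 pt1; have L0 : 0 < t1 + t2 by lra.
have := phase_itv t L0; move: p0 pt1; rewrite {1 2 3 4}/phase.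
set m := Num.floor _; set k := m%:~R * _ => p0 pt1 pL.
have phE u : k <= u -> u < k + (t1 + t2) -> phase (t1 + t2) u = u - k by apply: phaseE.
have p0' : 0 < t - k by rewrite lt_neqAle eq_sym p0; lra.
have fk : is_derive (t : R^o) 1 ((fun u => f (u - k)) : R^o -> R^o) (df (t - k)).
  have d : is_derive (t : R^o) 1 ((fun u => u - k) : R^o -> R^o) 1.
    by apply: (is_derive_eq _); rewrite subr0.
  by have := @is_derive1_comp _ f (fun u => u - k) t _ _ (fdf (t - k)) d; rewrite mulr1.
have gk : is_derive (t : R^o) 1 ((fun u => g (u - k - t1)) : R^o -> R^o) (dg (t - k - t1)).
  have d : is_derive (t : R^o) 1 ((fun u => u - k - t1) : R^o -> R^o) 1.
    by apply: (is_derive_eq _); rewrite !subr0.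
  have := @is_derive1_comp _ g (fun u => u - k - t1) t _ _ (gdg (t - k - t1)) d.
  by rewrite mulr1.
rewrite phE; [|lra|lra]; rewrite /concat; have [pt|pt] := leP (t - k) t1.
  have pt' : t - k < t1 by rewrite lt_neqAle pt1.
  apply: (near_eq_is_derive _ fk).
  apply/nbhs_normP; exists (Num.min (t - k) (t1 - (t - k))) => /=.
    by rewrite lt_min p0' subr_gt0.
  move=> u /=; rewrite lt_min => /andP[/ltr_normlP[u1 u2] /ltr_normlP[u3 u4]].
  by rewrite /glued /concat phE; [rewrite ifT //|..]; lra.
apply: (near_eq_is_derive _ gk).
apply/nbhs_normP; exists (Num.min (t - k - t1) (t1 + t2 - (t - k))) => /=.
  by rewrite lt_min !subr_gt0 pt; lra.
move=> u /=; rewrite lt_min => /andP[/ltr_normlP[u1 u2] /ltr_normlP[u3 u4]].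
rewrite /glued /concat phE; [rewrite ifF //|..]; try lra.
Qed.

End TwoPieces.

(** There are two breakpoints per period, hence countably many. *)
Lemma breakpoints_negligible t1 t2 : 0 < t1 -> 0 < t2 ->
  {ae mu, forall t, phase (t1 + t2) t != 0 /\ phase (t1 + t2) t != t1}.
Proof.
move=> t10 t20.
pose B := \bigcup_(m in [set: int]) [set m%:~R * (t1 + t2); m%:~R * (t1 + t2) + t1].
have cB : countable B.
  by apply: bigcup_countable => // m _; exact: finite_set_countable.
exists B; split.
- exact: countable_measurable.
- exact: countable_lebesgue_measure0.
move=> t /= nt; exists (Num.floor (t / (t1 + t2))) => //.
have [p0|p0] := eqVneq (phase (t1 + t2) t) 0.
  by left; move: p0 => /eqP; rewrite subr_eq0 => /eqP.
right; apply: contrapT => pt; apply: nt; split => //; apply/eqP => p1.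
by apply: pt => /=; move: p1; rewrite /phase; lra.
Qed.

End Gluing.

(** * Periodic orbits from smooth pieces, symmetry and neighbourhoods in the plane *)

Section LimitCycles.
Context {R : realType}.
Implicit Types (al a b c d r s t : R) (z w : R[i]).

Definition C1_path (g v : R -> R[i]) : Prop :=
  [/\ forall t, is_derive (t : R^o) 1
        ((fun s => complex.Re (g s)) : R^o -> R^o) (complex.Re (v t)),
      forall t, is_derive (t : R^o) 1
        ((fun s => complex.Im (g s)) : R^o -> R^o) (complex.Im (v t)),
      continuous (fun t => complex.Re (v t)) &
      continuous (fun t => complex.Im (v t))].

Lemma concat_comp (A B : Type) (h : A -> B) (g1 g2 : R -> A) t1 r :
  h (concat t1 g1 g2 r) = concat t1 (fun s => h (g1 s)) (fun s => h (g2 s)) r.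
Proof. by rewrite /concat; case: ifP. Qed.

(** The periodic extension is Lipschitz, hence absolutely continuous, and follows the field except
    at the breakpoints, a null set. That [g1] takes different values at 0 and [t1] makes the curve
    nonconstant. *)
Lemma glued_periodic_orbit (Fp Fm : {poly R[i]}) g1 v1 g2 v2 t1 t2 :
  0 < t1 -> 0 < t2 -> C1_path g1 v1 -> C1_path g2 v2 ->
  g1 t1 = g2 0 -> g2 t2 = g1 0 -> g1 0 <> g1 t1 ->
  (forall r, 0 < r -> r < t1 -> filippov_field Fp Fm (g1 r) (v1 r)) ->
  (forall r, 0 < r -> r < t2 -> filippov_field Fp Fm (g2 r) (v2 r)) ->
  periodic_orbit Fp Fm (concat t1 g1 g2 @` `[0, t1 + t2]).
Proof.
move=> t10 t20 [dx1 dy1 cx1 cy1] [dx2 dy2 cx2 cy2] g12 g21 ne fld1 fld2.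
have L0 : 0 < t1 + t2 by lra.
pose gamma t := concat t1 g1 g2 (phase (t1 + t2) t).
exists gamma, (t1 + t2); split.
- have reE t : complex.Re (gamma t) = concat t1 (fun s => complex.Re (g1 s))
      (fun s => complex.Re (g2 s)) (phase (t1 + t2) t).
    exact: concat_comp.
  have imE t : complex.Im (gamma t) = concat t1 (fun s => complex.Im (g1 s))
      (fun s => complex.Im (g2 s)) (phase (t1 + t2) t).
    exact: concat_comp.
  have x12 : complex.Re (g1 t1) = complex.Re (g2 0) by rewrite g12.
  have y12 : complex.Im (g1 t1) = complex.Im (g2 0) by rewrite g12.
  have x21 : complex.Re (g2 t2) = complex.Re (g1 0) by rewrite g21.
  have y21 : complex.Im (g2 t2) = complex.Im (g1 0) by rewrite g21.
  rewrite /filippov_solution /= (funext reE) (funext imE); split.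
    by move=> a b; split; apply: glued_abs_continuous; eassumption.
  apply: ae_imply (breakpoints_negligible t10 t20) => t [p0 pt1].
  exists (concat t1 v1 v2 (phase (t1 + t2) t)).
    have := phase_itv t L0; move: p0 pt1; rewrite /gamma.
    set p := phase _ _ => p0 pt1 pL.
    have p0' : 0 < p by rewrite lt_neqAle eq_sym p0; lra.
    rewrite /concat; have [pt|pt] := leP p t1.
      by apply: fld1 => //; rewrite lt_neqAle pt1.
    by apply: fld2; lra.
  rewrite (concat_comp (@complex.Re R)) (concat_comp (@complex.Im R)).
  by split; apply: glued_is_derive.
- by split => // t; rewrite /gamma phase_periodic.
- have p0 : phase (t1 + t2) 0 = 0 by apply: phase_id.
  have p1 : phase (t1 + t2) t1 = t1 by apply: phase_id; lra.
  by exists 0, t1; rewrite /gamma p0 p1 /concat (ltW t10) lexx.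
- apply: range_phase => //.
  have c1 : (t1 + t2 <= t1) = false by apply/negbTE; rewrite -ltNge; lra.
  by rewrite /concat c1 (ltW t10) addrAC subrr add0r.
Qed.

Lemma C1_path_opp g v : C1_path g v -> C1_path (fun t => - g t) (fun t => - v t).
Proof.
case=> dx dy cx cy.
have reN (u : R -> R[i]) : (fun t => complex.Re (- u t)) = (fun t => - complex.Re (u t)).
  by apply/funext => t; case: (u t).
have imN (u : R -> R[i]) : (fun t => complex.Im (- u t)) = (fun t => - complex.Im (u t)).
  by apply/funext => t; case: (u t).
split; rewrite ?reN ?imN.
- by move=> t; have := is_deriveN (dx t); case: (v t).
- by move=> t; have := is_deriveN (dy t); case: (v t).
- by move=> t; apply: cvgN; exact: cx.
- by move=> t; apply: cvgN; exact: cy.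
Qed.

Definition arc_velocity al a r : R[i] :=
  (al * (arc_x al a r - 1) - (arc_y al a r - 1)) +i*
  ((arc_x al a r - 1) + al * (arc_y al a r - 1)).

Lemma C1_path_arc al a : C1_path (arc al a) (arc_velocity al a).
Proof.
have dx t : is_derive (t : R^o) 1 (arc_x al a : R^o -> R^o) (complex.Re (arc_velocity al a t)).
  by apply: (is_derive_eq _); rewrite /GRing.scale /= /arc_x /arc_y; ring.
have dy t : is_derive (t : R^o) 1 (arc_y al a : R^o -> R^o) (complex.Im (arc_velocity al a t)).
  by apply: (is_derive_eq _); rewrite /GRing.scale /= /arc_x /arc_y; ring.
have cx t : {for t, continuous (arc_x al a)} by exact: is_derive_continuous (dx t).
have cy t : {for t, continuous (arc_y al a)} by exact: is_derive_continuous (dy t).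
split => // t /=.
- apply: cvgB; last by apply: cvgB; [exact: cy|exact: cvg_cst].
  by apply: cvgM; [exact: cvg_cst|apply: cvgB; [exact: cx|exact: cvg_cst]].
- apply: cvgD; first by apply: cvgB; [exact: cx|exact: cvg_cst].
  by apply: cvgM; [exact: cvg_cst|apply: cvgB; [exact: cy|exact: cvg_cst]].
Qed.

Lemma C1_path_slide a k :
  C1_path (fun r => (a * expR (k * r)) +i* 0) (fun r => (k * (a * expR (k * r))) +i* 0).
Proof.
have dx t : is_derive (t : R^o) 1
    ((fun r => a * expR (k * r)) : R^o -> R^o) (k * (a * expR (k * t))).
  by apply: (is_derive_eq _); rewrite /GRing.scale /=; ring.
have dx' t : is_derive (t : R^o) 1
    ((fun r => k * (a * expR (k * r))) : R^o -> R^o) (k * (k * (a * expR (k * t)))).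
  by apply: (is_derive_eq _); rewrite /GRing.scale /=; ring.
split => //= t; [exact: is_derive_cst|exact: is_derive_continuous (dx' t)|exact: cvg_cst].
Qed.

Lemma arc_field al a r : 0 < arc_y al a r ->
  filippov_field (upper_poly al) (lower_poly al) (arc al a r) (arc_velocity al a r).
Proof.
by move=> y0; apply/filippov_fieldE; split => //= h; exfalso; lra.
Qed.

Lemma opp_field al z w :
  filippov_field (upper_poly al) (lower_poly al) z w ->
  filippov_field (upper_poly al) (lower_poly al) (- z) (- w).
Proof.
move/filippov_fieldE/coord_field_opp => H; apply/filippov_fieldE.
by case: z w H => [? ?] [? ?].
Qed.

Lemma slide_field al c : 0 < al -> 0 < c -> c <= 1 + al ->
  filippov_field (upper_poly al) (lower_poly al) (c +i* 0) ((slide_rate al * c) +i* 0).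
Proof.
move=> al0 c0 c1; apply/filippov_fieldE; split => /=; rewrite ?ltxx // => _.
have a1 : 1 + al != 0 by rewrite gt_eqF //; lra.
(* The weight that cancels the vertical component; it lies in [[0, 1]] exactly because [c] is in the
   sliding segment. *)
exists ((1 + c / (1 + al)) / 2).
  have : 0 <= c / (1 + al) by rewrite divr_ge0; lra.
  have : c / (1 + al) <= 1 by rewrite ler_pdivrMr; lra.
  by move=> ? ?; apply/andP; split; lra.
by rewrite /slide_rate; split; field.
Qed.

Lemma periodic_orbit_opp al (G : set R[i]) :
  periodic_orbit (upper_poly al) (lower_poly al) G ->
  periodic_orbit (upper_poly al) (lower_poly al) (-%R @` G).
Proof.
move=> [gamma [T [/filippov_solutionE sol [T0 gT] [s [t st]] <-]]].
exists (fun t => - gamma t), T; split.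
- apply/filippov_solutionE; have := coord_solution_opp sol.
  by congr (coord_solution _ _ _); apply/funext => u /=; case: (gamma u).
- by split => // u; rewrite gT.
- by exists s, t => /oppr_inj.
- by rewrite image_comp.
Qed.

Lemma normc_ge_Im z : `|complex.Im z|%:C <= `|z|.
Proof. by case: z => a b; simpc; rewrite -sqrtr_sqr ler_wsqrtr // lerDr sqr_ge0. Qed.

(** Both coordinates are bounded by the modulus, so regions given by strict inequalities on
    coordinates can be shown to be open. *)
Lemma nbhs_complex_box z e : 0 < e ->
  nbhs (z : R[i]^o) [set w : R[i]^o | `|complex.Re w - complex.Re z| < e /\
                                      `|complex.Im w - complex.Im z| < e].
Proof.
move=> e0; apply: (proj2 (@nbhs_normP _ (R[i]^o) z _)).
exists (e%:C) => /=; first by rewrite ltcR.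
move=> w /= zw.
have H : `|w - z| < e%:C by rewrite distrC.
have h1 := le_lt_trans (normc_ge_Re (w - z)) H.
have h2 := le_lt_trans (normc_ge_Im (w - z)) H.
by move: h1 h2; rewrite !ltcR; case: (w) (z) => [? ?] [? ?].
Qed.

End LimitCycles.

(** * Isolation and distinction of the three limit cycles *)

Section ThreeCycles.
Context {R : realType}.
Implicit Types (al a b c d r s t : R) (z w : R[i]).

Lemma orbit_coordinates al (G : set R[i]) :
  periodic_orbit (upper_poly al) (lower_poly al) G ->
  exists x y : R -> R, exists T s0 s1 : R,
    [/\ coord_solution al x y, 0 < T,
        forall t, x (t + T) = x t /\ y (t + T) = y t,
        x s0 +i* y s0 != x s1 +i* y s1 &
        G = range (fun t => x t +i* y t)].
Proof.
move=> [gamma [T [/filippov_solutionE sol [T0 gT] [s0 [s1 ne]] <-]]].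
have gE t : complex.Re (gamma t) +i* complex.Im (gamma t) = gamma t by case: (gamma t).
exists (fun t => complex.Re (gamma t)), (fun t => complex.Im (gamma t)), T, s0, s1.
split => //; first by move=> t; rewrite gT.
- by rewrite !gE; apply/eqP.
- by rewrite (funext gE).
Qed.

(** This set isolates the sliding cycle: it meets the axis only at positive abscissas and allows no
    point with [y <= -1]. *)
Lemma open_sliding_region :
  open [set w : R[i]^o | 0 < complex.Im w \/ 0 < complex.Re w /\ -1 < complex.Im w].
Proof.
rewrite openE => -[zx zy] /= [zy0|[zx0 zy1]].
  have := @nbhs_complex_box R (zx +i* zy) zy zy0; apply: filterS => -[wx wy] /= [_].
  by move=> /ltr_normlP[? ?]; left; lra.
have m0 : 0 < Num.min zx (zy + 1) by rewrite lt_min zx0; lra.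
have := @nbhs_complex_box R (zx +i* zy) _ m0; apply: filterS => -[wx wy] /=.
by rewrite !lt_min => -[/andP[/ltr_normlP[? ?] _] /andP[_ /ltr_normlP[? ?]]]; right; lra.
Qed.

(** This set isolates the crossing cycle; it keeps orbits away from the sliding segment and both
    folds. *)
Lemma open_crossing_region :
  open [set w : R[i]^o | complex.Im w = 0 -> 2 < `|complex.Re w|].
Proof.
rewrite openE => -[zx zy] /= zP; have [zy0|zy0] := eqVneq zy 0.
  have m0 : 0 < `|zx| - 2 by rewrite subr_gt0 zP.
  have := @nbhs_complex_box R (zx +i* zy) _ m0; apply: filterS => -[wx wy] /= [h _] _.
  by have := ler_normD wx (zx - wx); rewrite [wx + _]addrC subrK distrC; lra.
have m0 : 0 < `|zy| by rewrite normr_gt0.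
have := @nbhs_complex_box R (zx +i* zy) _ m0; apply: filterS => -[wx wy] /= [_ h] wy0.
by move: h; rewrite wy0 sub0r normrN ltxx.
Qed.

Lemma limit_cycle_opp al (G : set R[i]) :
  limit_cycles (upper_poly al) (lower_poly al) G ->
  limit_cycles (upper_poly al) (lower_poly al) (-%R @` G).
Proof.
have oppK (H : set R[i]) : -%R @` (-%R @` H) = H.
  rewrite image_comp; apply/seteqP; split => z; first by move=> [w Hw <-]; rewrite /= opprK.
  by move=> Hz; exists z; rewrite //= opprK.
move=> [pG [U [oU GU uniq]]]; split; first exact: periodic_orbit_opp.
exists ((-%R : R[i]^o -> R[i]^o) @^-1` U); split.
- by apply: open_comp => // z _; exact: opp_continuous.
- by move=> z [w Gw <-]; rewrite /= opprK; exact: GU.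
- move=> G' pG' G'U; rewrite -(oppK G'); congr (_ @` _); apply: uniq.
    exact: periodic_orbit_opp.
  by move=> z [w G'w <-]; exact: G'U.
Qed.

(** The spiral from the fold and the slide back form the orbit. The position relative to the axis is
    recorded to tell the cycles apart. *)
Lemma sliding_limit_cycle al : 0 < al -> al <= 1 / 100 -> exists G,
  [/\ limit_cycles (upper_poly al) (lower_poly al) G,
      exists2 z, G z & 0 < complex.Im z & forall z, G z -> 0 <= complex.Im z].
Proof.
move=> al0 al1; have [b [b1 b0] lev] := landing_on_sliding al0 al1.
have [t1 [t10 ypos yt1 xt1]] := arc_of_arrival al0 (lexx _) (ltW b1) lev.
have k0 : 0 < slide_rate al by rewrite /slide_rate ltr_pwDl // divr_ge0; lra.
pose x1 := arc_x al (1 + al) t1.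
have x10 : 0 < x1 by rewrite /x1 xt1; lra.
have x11 : x1 < 1 by rewrite /x1 xt1; lra.
(* This is the time needed to slide from the landing point [x1] back to the fold. *)
pose T2 := ln ((1 + al) / x1) / slide_rate al.
have q1 : 1 < (1 + al) / x1 by rewrite ltr_pdivlMr // mul1r; lra.
have T20 : 0 < T2 by rewrite divr_gt0 ?ln_gt0.
have xT2 : x1 * expR (slide_rate al * T2) = 1 + al.
  rewrite /T2 mulrC [slide_rate al * _]mulrC divfK ?gt_eqF // lnK ?divfK ?gt_eqF //.
  by rewrite posrE; lra.
have slide_le r : r < T2 -> x1 * expR (slide_rate al * r) <= 1 + al.
  by move=> rT; rewrite -xT2 ler_pM2l // ler_expR ler_pM2l // ltW.
have arct1 : arc al (1 + al) t1 = x1 +i* 0 by rewrite /arc yt1.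
exists (sliding_loop al t1 @` `[0, t1 + T2]); split.
- split.
    apply: (glued_periodic_orbit t10 T20 (C1_path_arc al (1 + al))
      (C1_path_slide x1 (slide_rate al))).
    + by rewrite arct1 mulr0 expR0 mulr1.
    + by rewrite xT2 arc0.
    + by rewrite arct1 arc0 => -[]; lra.
    + by move=> r r0 rt; apply: arc_field; exact: ypos.
    + by move=> r r0 rt; apply: slide_field; rewrite ?mulr_gt0 ?expR_gt0 ?slide_le.
  exists [set w : R[i]^o | 0 < complex.Im w \/ 0 < complex.Re w /\ -1 < complex.Im w].
  split; first exact: open_sliding_region.
    move=> z [r]; rewrite /= in_itv /= => r0L <-; rewrite /sliding_loop /concat.
    case: ifPn => [rt1|_]; last by right; rewrite /= ltrN10 mulr_gt0 ?expR_gt0.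
    have [r0|r0] := eqVneq r 0; first by rewrite r0 arc0 /=; right; split; lra.
    have [rt|rt] := eqVneq r t1; first by rewrite rt arct1 /=; right; split; lra.
    by left; apply: ypos; rewrite lt_neqAle ?rt ?rt1 // eq_sym r0; lra.
  move=> G' /orbit_coordinates[x [y [T [s0 [s1 [sol T0 per ne ->]]]]]] sub.
  have xT t : x (t + T) = x t by have [] := per t.
  have yT t : y (t + T) = y t by have [] := per t.
  have al1' : al <= 1 by lra.
  apply: (sliding_orbit_unique sol xT yT al0 al1' T0 t10 ypos yt1 x10 T20 xT2 _ ne).
  by move=> t; apply: (sub (x t +i* y t)); exists t.
- exists (arc al (1 + al) (t1 / 2)).
    exists (t1 / 2); first by rewrite /= in_itv /=; lra.
    by rewrite /sliding_loop /concat ifT //; lra.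
  by rewrite /=; apply: ypos; lra.
- move=> z [r]; rewrite /= in_itv /= => r0L <-; rewrite /sliding_loop /concat.
  case: ifPn => [rt1|_] //=.
  have [r0|r0] := eqVneq r 0.
    by rewrite r0; have := arc0 al (1 + al); rewrite /arc => -[_ ->].
  have [rt|rt] := eqVneq r t1; first by rewrite rt yt1.
  by apply/ltW/ypos; rewrite lt_neqAle ?rt ?rt1 // eq_sym r0; lra.
Qed.

(** The zero of [displacement] gives an arc from [a] to [-a], closed up by its opposite. This cycle
    visits both open half planes, unlike the two sliding ones. *)
Lemma crossing_limit_cycle al : 0 < al -> al <= 1 / 100 -> exists G,
  [/\ limit_cycles (upper_poly al) (lower_poly al) G,
      exists2 z, G z & 0 < complex.Im z & exists2 z, G z & complex.Im z < 0].
Proof.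
move=> al0 al1; have [a a2 [Da outer inner]] := displacement_root al0 al1.
have lev : departure al a = arrival al a.
  by apply/eqP; rewrite -subr_eq0 -/(displacement al a) Da.
have [||t1 [t10 ypos yt1 xt1]] := arc_of_arrival al0 _ _ lev; [lra|lra|].
have arct1 : arc al a t1 = - a +i* 0 by rewrite /arc yt1 xt1.
have oppE c d : - (c +i* d) = (- c) +i* (- d) :> R[i] by [].
exists (crossing_loop al a t1 @` `[0, t1 + t1]); split.
- split.
    apply: (glued_periodic_orbit t10 t10 (C1_path_arc al a) (C1_path_opp (C1_path_arc al a))).
    + by rewrite arct1 arc0 oppE oppr0.
    + by rewrite arct1 arc0 oppE oppr0 opprK.
    + by rewrite arct1 arc0 => -[]; lra.
    + by move=> r r0 rt; apply: arc_field; exact: ypos.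
    + by move=> r r0 rt; apply/opp_field/arc_field; exact: ypos.
  exists [set w : R[i]^o | complex.Im w = 0 -> 2 < `|complex.Re w|].
  split; first exact: open_crossing_region.
    have arcU r : 0 <= r -> r <= t1 -> complex.Im (arc al a r) = 0 ->
        2 < `|complex.Re (arc al a r)|.
      move=> r0' rt1'; have [->|r0] := eqVneq r 0; first by rewrite arc0 /= gtr0_norm; lra.
      have [->|rt] := eqVneq r t1; first by rewrite arct1 /= normrN gtr0_norm; lra.
      suff : 0 < arc_y al a r by move=> /= h1 h2; lra.
      by apply: ypos; rewrite lt_neqAle ?rt ?rt1' // eq_sym r0.
    move=> z [r]; rewrite /= in_itv /= => r0L <-; rewrite /crossing_loop /concat.
    case: ifPn => [rt1|]; first by apply: arcU => //; lra.
    rewrite -ltNge => rt1 /= /eqP; rewrite oppr_eq0 => /eqP h.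
    by rewrite normrN; apply: (arcU (r - t1)) => //; lra.
  move=> G' /orbit_coordinates[x [y [T [s0 [s1 [sol T0 per ne ->]]]]]] sub.
  have xT t : x (t + T) = x t by have [] := per t.
  have yT t : y (t + T) = y t by have [] := per t.
  apply: (crossing_orbit_unique sol al0 al1 T0 xT yT a2 outer inner t10 ypos yt1 xt1 _ ne).
  by move=> t; apply: (sub (x t +i* y t)); exists t.
- exists (arc al a (t1 / 2)).
    exists (t1 / 2); first by rewrite /= in_itv /=; lra.
    by rewrite /crossing_loop /concat ifT //; lra.
  by rewrite /=; apply: ypos; lra.
- exists (- arc al a (t1 / 2)).
    exists (t1 + t1 / 2); first by rewrite /= in_itv /=; lra.
    rewrite /crossing_loop /concat ifF; last by apply/negbTE; rewrite -ltNge; lra.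
    by rewrite addrAC subrr add0r.
  by rewrite /= oppr_lt0; apply: ypos; lra.
Qed.

Lemma counting_ge3 (T : choiceType) (A : set T) (p q r : T) :
  A p -> A q -> A r -> p != q -> p != r -> q != r ->
  ((3 : R)%:E <= counting A)%E.
Proof.
move=> Ap Aq Ar pq pr qr; rewrite /counting; case: asboolP => fA; last exact: leey.
rewrite lee_fin ler_nat; apply: (@uniq_leq_size _ [:: p; q; r]).
  by rewrite /= !inE negb_or pq pr qr.
by move=> z; rewrite !inE in_fset_set // => /or3P[] /eqP ->; exact/mem_set.
Qed.

(** The sliding cycle lies in the closed upper half plane and enters the open one, its opposite lies
    in the closed lower half plane, and the crossing cycle visits both open half planes; so they
    differ pairwise. *)
Lemma three_limit_cycles al : 0 < al -> al <= 1 / 100 ->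
  ((3 : R)%:E <= num_limit_cycles (upper_poly al) (lower_poly al))%E.
Proof.
move=> al0 al1.
have [G [lG [zG GzG zG0] Gpos]] := sliding_limit_cycle al0 al1.
have [H [lH [z1 Hz1 z10] [z2 Hz2 z20]]] := crossing_limit_cycle al0 al1.
have NGneg z : (-%R @` G) z -> complex.Im z <= 0.
  by move=> [w /Gpos + <-]; case: w => u v /=; rewrite oppr_le0.
apply: (counting_ge3 lG (limit_cycle_opp lG) lH); apply/eqP => E.
- by move: GzG; rewrite E => /NGneg; lra.
- by move: Hz2; rewrite -E => /Gpos; lra.
- by move: Hz1; rewrite -E => /NGneg; lra.
Qed.

End ThreeCycles.

Theorem theoremC (R : realType) :
  (exists Fp Fm : {poly R[i]},
     [/\ size Fp = 2%N, size Fm = 2%N &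
         ((3 : R)%:E <= num_limit_cycles Fp Fm)%E]) /\
  ((3 : R)%:E <= max_limit_cycles R 1 1)%E.
Proof.
have al0 : 0 < 1 / 100 :> R by rewrite divr_gt0.
have H := three_limit_cycles al0 (lexx _).
split.
  exists (upper_poly (1 / 100)), (lower_poly (1 / 100)).
  by split; rewrite ?size_upper_poly ?size_lower_poly.
apply: (le_trans H); apply: ereal_sup_ubound.
exists (upper_poly (1 / 100), lower_poly (1 / 100)) => //=.
by split; rewrite ?size_upper_poly ?size_lower_poly.
Qed.
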